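(* Let $\Phi=(G,\varphi)$ be a complex unit gain graph of order $n$ with $r(\Phi)=r(G)-2\theta(G)$. Then (a) the cycles (if any) of $G$ are pairwise vertex-disjoint; (b) each cycle $C_p^{\varphi}$ (if any) of $\Phi$ is of Type A with order $p\equiv 2\pmod 4$; (c) $r(G)=r(T_G)+\sum_{O\in\mathcal{C}(G)}|V(O)|$ and $r(T_G)=r(\Gamma_G)$.
   Context: A complex unit gain graph $\Phi=(G,\varphi)$ consists of a finite simple graph $G$ with vertex set $\{v_1,\dots,v_n\}$ and a gain function $\varphi$ assigning to each oriented edge $e_{ij}$ ($v_iv_j\in E(G)$) a complex number of modulus $1$ with $\varphi(e_{ji})=\overline{\varphi(e_{ij})}$. $A(\Phi)$ is the Hermitian matrix with $(i,j)$ entry $\varphi(e_{ij})$ if $v_iv_j\in E(G)$ and $0$ otherwise; $r(\Phi)$ is its rank; $r(\cdot)$ of a simple graph is the rank of its $0$-$1$ adjacency matrix. $\theta(G)=|E(G)|-|V(G)|+\omega(G)$, $\omega(G)$ the number of components. For a gain cycle with vertices $v_1,\dots,v_p$ in cyclic order, $\varphi(C_p)=\varphi(e_{12})\cdots\varphi(e_{p1})$; for $p$ even it is of Type A if $\varphi(C_p)=(-1)^{p/2}$. For a graph $G$ whose cycles are pairwise vertex-disjoint, $\mathcal{C}(G)$ is its set of cycles, and $T_G$ is the acyclic graph obtained by contracting each cycle $O$ to a vertex $t_O$: its vertex set is $U\cup C_G$, where $U$ is the set of vertices of $G$ on no cycle and $C_G=\{t_O:O\in\mathcal{C}(G)\}$;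 $u_1,u_2\in U$ are adjacent iff $u_1u_2\in E(G)$; $u\in U$ is adjacent to $t_O$ iff $u$ is adjacent in $G$ to some vertex of $O$; $t_{O_1},t_{O_2}$ are adjacent iff some edge of $G$ joins a vertex of $O_1$ to a vertex of $O_2$. $\Gamma_G$ is obtained from $T_G$ by deleting the vertices of $C_G$ and their incident edges. *)

(* Defs.v *)
From HB Require Import structures.
From mathcomp Require Import all_boot all_order all_algebra.
Set Implicit Arguments. Unset Strict Implicit. Unset Printing Implicit Defensive.
Import Order.TTheory GRing.Theory Num.Theory.

(* A simple graph on vertex set 'I_n is a symmetric irreflexive relation G.
   A complex unit gain graph additionally carries phi : 'I_n -> 'I_n -> C,
   C an algebraically closed numeric field (e.g. the complex numbers). *)

Section Defs.
Variable C : numClosedFieldType.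
Variable n : nat.
Local Open Scope ring_scope.
Implicit Types (G : rel 'I_n) (phi : 'I_n -> 'I_n -> C) (s : seq 'I_n).

Definition unit_gain G phi : Prop :=
  forall i j, G i j -> `|phi i j| = 1 /\ phi j i = (phi i j)^*.


Definition gain_adj G phi : 'M[C]_n := \matrix_(i, j) (if G i j then phi i j else 0).
Definition adj G : 'M[C]_n := \matrix_(i, j) (G i j)%:R.

Definition rank_gain G phi : nat := \rank (gain_adj G phi).
Definition rank_graph G : nat := \rank (adj G).

Definition edges G : {set 'I_n * 'I_n} := [set p : 'I_n * 'I_n | (p.1 < p.2)%N && G p.1 p.2].
Definition ncomp G : nat := n_comp G predT.
Definition theta G : int := (#|edges G|)%:Z - n%:Z + (ncomp G)%:Z.

Definition is_cyc G s : bool := [&& (3 <= size s)%N, uniq s & cycle G s].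

(* the (symmetric) edge set of the cycle given by s: identifies the cycle as a subgraph *)
Definition cycle_edges s : {set 'I_n * 'I_n} :=
  [set p : 'I_n * 'I_n | (p \in zip s (rot 1 s)) || ((p.2, p.1) \in zip s (rot 1 s))].

Definition vset (E : {set 'I_n * 'I_n}) : {set 'I_n} := [set x | [exists y, (x, y) \in E]].

Definition gain_of phi s : C := \prod_(p <- zip s (rot 1 s)) phi p.1 p.2.

(* boolean existence of a cycle with property P (a cycle has at most n vertices) *)
Definition ex_cycle G (P : seq 'I_n -> bool) : bool :=
  [exists k : 'I_n.+1, [exists t : k.-tuple 'I_n, is_cyc G t && P t]].

Definition cycles G : {set {set 'I_n * 'I_n}} :=
  [set E | ex_cycle G (fun s => cycle_edges s == E)].

Definition on_cycle G x : bool := ex_cycle G (fun s => x \in s).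

(* x, y are identified in T_G: equal, or on a common cycle *)
Definition same_node G x y : bool := (x == y) || ex_cycle G (fun s => (x \in s) && (y \in s)).

(* each vertex of T_G is represented by the least vertex of G it comes from *)
Definition is_rep G x : bool := [forall z, same_node G x z ==> (x <= z)%N].

(* adjacency matrix of T_G, with vertices of T_G represented by is_rep vertices
   (rows/columns of non-representatives are zero, which does not affect the rank) *)
Definition adjT G : 'M[C]_n :=
  \matrix_(a, b) ([&& is_rep G a, is_rep G b, a != b &
     [exists x, exists y, [&& same_node G a x, same_node G b y & G x y]]])%:R.

Definition adjGamma G : 'M[C]_n :=
  \matrix_(a, b) ([&& ~~ on_cycle G a, ~~ on_cycle G b & G a b])%:R.

Definition rank_T G : nat := \rank (adjT G).
Definition rank_Gamma G : nat := \rank (adjGamma G).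

End Defs.

(* Main.v *)
Require Import Defs.
From HB Require Import structures.
From mathcomp Require Import all_boot all_order all_algebra.
From mathcomp Require Import zify.
Set Implicit Arguments. Unset Strict Implicit. Unset Printing Implicit Defensive.
Import Order.TTheory GRing.Theory Num.Theory.

(** The bound [r(Phi) >= r(G) - 2 theta(G)] is proved by deleting a vertex [x] on a
    cycle: [r(Phi)] does not grow, [r(G)] drops by at most 2 and [theta] by at least 1;
    for forests both ranks agree, as both drop by 2 when a pendant edge is removed.  If
    equality holds for [G] it therefore holds for [G - x], with [r(G) = r(G - x) + 2] and
    [theta(G) = theta(G - x) + 1]; in particular [x] lies on one cycle only, which is (a).
    Equality also survives the deletion of a pendant vertex together with its neighbour,
    and that neighbour lies on no cycle.

    A bridge with an inclusion-minimal side cuts off either a pendant vertex or, given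
    (a), a single cycle.  For (b), deleting pendant edges and vertices of the other
    cycles reduces [G] to one cycle, where a kernel vector is propagated in steps of two.
    For (c), let [O], of length [p = 2 mod 4], be attached by the bridge [vu], [v] on [O].
    Deleting [v], or instead a neighbour of [v] on [O], and then peeling off the rest of
    [O] by pendant edges gives [r(G) = p + r(G - O) = p + 2 + r(G - O - u)], with equality
    inherited by [G - O] and [G - O - u]; since [t_O] is a leaf of [T_G] at [u], also
    [r(T_G) = 2 + r(T_(G - O - u))], and induction applies to both smaller graphs. *)

(** * Deletion and the cyclomatic number *)

Definition is_graph n (G : rel 'I_n) := symmetric G /\ irreflexive G.

Definition del_edge n (G : rel 'I_n) (x y : 'I_n) : rel 'I_n :=
  fun a b => G a b && ~~ ((a == x) && (b == y) || (a == y) && (b == x)).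

(* Deleted vertices stay in ['I_n] as isolated vertices: this changes neither
   the ranks nor [theta]. *)
Definition del_vertices n (X : {set 'I_n}) (G : rel 'I_n) : rel 'I_n :=
  fun a b => [&& a \notin X, b \notin X & G a b].

Lemma del_edge_sub n (G : rel 'I_n) x y : subrel (del_edge G x y) G.
Proof. by move=> a b /andP[]. Qed.

Lemma del_edgeC n (G : rel 'I_n) x y : del_edge G x y =2 del_edge G y x.
Proof. by move=> a b; rewrite /del_edge orbC. Qed.

Lemma del_edge_graph n (G : rel 'I_n) x y : is_graph G -> is_graph (del_edge G x y).
Proof.
move=> [sG iG]; split=> [a b|a]; last by rewrite /del_edge iG.
by rewrite /del_edge sG orbC ![(b == _) && _]andbC.
Qed.

Lemma del_vertices_sub n X (G : rel 'I_n) : subrel (del_vertices X G) G.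
Proof. by move=> a b /and3P[]. Qed.

Lemma del_vertices_graph n X (G : rel 'I_n) :
  is_graph G -> is_graph (del_vertices X G).
Proof.
move=> [sG iG]; split=> [a b|a]; last by rewrite /del_vertices iG !andbF.
by rewrite /del_vertices sG; case: (a \in X); case: (b \in X).
Qed.

Lemma del_verticesU n X Y (G : rel 'I_n) :
  del_vertices X (del_vertices Y G) =2 del_vertices (X :|: Y) G.
Proof.
move=> a b; rewrite /del_vertices !inE.
by case: (a \in X); case: (b \in X); case: (a \in Y); case: (b \in Y).
Qed.

Lemma graph_neq n (G : rel 'I_n) x y : is_graph G -> G x y -> x != y.
Proof. by move=> [_ iG]; apply: contraTneq => ->; rewrite iG. Qed.

Lemma connect_mono n (G H : rel 'I_n) :
  subrel G H -> subrel (connect G) (connect H).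
Proof. by move=> sub; apply: connect_sub => x y /sub; apply: connect1. Qed.

Lemma graph_connect_sym n (G : rel 'I_n) : is_graph G -> connect_sym G.
Proof. by case=> sG _; apply: sym_connect_sym. Qed.

Lemma connect_ind n (e : rel 'I_n) x (P : 'I_n -> Prop) :
  P x -> (forall y z, connect e x y -> P y -> e y z -> P z) ->
  forall z, connect e x z -> P z.
Proof.
move=> Px step z /connectP[p pth ->]; elim/last_ind: p pth => [//|p y IH].
rewrite rcons_path last_rcons => /andP[pth ey].
by apply: step ey; [apply/connectP; exists p | apply: IH].
Qed.

Lemma edges_del_edge n (G : rel 'I_n) x y : is_graph G -> G x y ->
  #|edges G| = #|edges (del_edge G x y)|.+1.
Proof.
move=> gG; wlog ltxy : x y / x < y => [hw|] Gxy.
  have [/hw->//|ltyx|/val_inj exy] := ltngtP x y.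
    rewrite (hw y x) // ?(gG.1 y) //.
    by congr _.+1; apply: eq_card => p; rewrite !inE del_edgeC.
  by rewrite exy gG.2 in Gxy.
rewrite (cardsD1 (x, y)) inE ltxy Gxy /= add1n; congr _.+1.
apply: eq_card => -[a b]; rewrite !inE /del_edge /= xpair_eqE.
case: (a =P y) => [->|_]; case: (b =P x) => [->|_] /=; rewrite ?orbF ?orbT ?andbF.
- by rewrite (leq_gtF (ltnW ltxy)) andbF.
all: by rewrite andbC andbA.
Qed.

(** A path need use the edge [xy] at most once, in one of two directions; hence the three cases. *)
Lemma connect_del_edge n (G : rel 'I_n) x y a b : is_graph G -> G x y ->
  connect G a b =
  [|| connect (del_edge G x y) a b,
      connect (del_edge G x y) a x && connect (del_edge G x y) y b
    | connect (del_edge G x y) a y && connect (del_edge G x y) x b].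
Proof.
move=> gG Gxy; set e := del_edge G x y.
have sub : subrel (connect e) (connect G) := connect_mono (@del_edge_sub _ G x y).
have cxy : connect G x y by apply: connect1.
have cyx : connect G y x by rewrite (graph_connect_sym gG).
apply/idP/idP; last first.
  case/or3P => [/sub//|/andP[/sub c1 /sub c2]|/andP[/sub c1 /sub c2]].
    exact: connect_trans (connect_trans c1 cxy) c2.
  exact: connect_trans (connect_trans c1 cyx) c2.
have [ce [ex ey]] : connect_sym e /\ (connect e x x /\ connect e y y).
  by split; [apply: graph_connect_sym; apply: del_edge_graph | split; apply: connect0].
move: b; apply: (connect_ind (P := fun b => is_true _)); first by rewrite connect0.
move=> p q _ IH Gpq; have [epq|nepq] := boolP (e p q).
  have tr r : connect e r p -> connect e r q.
    by move=> c; apply: connect_trans c (connect1 epq).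
  by case/or3P: IH => [/tr->//|/andP[-> /tr->]|/andP[-> /tr->]]; rewrite ?orbT.
(* The new edge is [xy] itself. In each case of the hypothesis [a] already reaches [x] or [y]
   without it, and the path is cut there. *)
move: nepq; rewrite /e /del_edge Gpq /= negbK.
case/orP => /andP[/eqP ep /eqP eq]; rewrite {}ep {}eq -/e in IH *.
  by case/or3P: IH => [->|/andP[->]|/andP[-> _]]; rewrite ?ey ?ex ?orbT ?andbT.
by case/or3P: IH => [->|/andP[-> _]|/andP[->]]; rewrite ?ey ?ex ?orbT ?andbT.
Qed.

Lemma ncomp_nonbridge n (G : rel 'I_n) x y : is_graph G -> G x y ->
  connect (del_edge G x y) x y -> ncomp (del_edge G x y) = ncomp G.
Proof.
move=> gG Gxy cxy; apply: eq_n_comp => a b.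
rewrite (connect_del_edge a b gG Gxy).
have cyx : connect (del_edge G x y) y x.
  by rewrite (graph_connect_sym (del_edge_graph x y gG)).
apply/idP/idP => [->//|/or3P[//|/andP[c1 c2]|/andP[c1 c2]]].
  exact: connect_trans (connect_trans c1 cxy) c2.
exact: connect_trans (connect_trans c1 cyx) c2.
Qed.

(* Mapping the roots of [G - xy] other than that of [y] to their roots in [G]
   is a bijection onto the roots of [G]. *)
Lemma ncomp_bridge n (G : rel 'I_n) x y : is_graph G -> G x y ->
  ~~ connect (del_edge G x y) x y -> ncomp (del_edge G x y) = (ncomp G).+1.
Proof.
move=> gG Gxy ncxy; set e := del_edge G x y.
have ge : is_graph e := del_edge_graph x y gG.
have se := graph_connect_sym ge; have sG := graph_connect_sym gG.
have nE (H : rel 'I_n) : ncomp H = #|[set z | roots H z]|.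
  by rewrite cardsE; apply: eq_card => z; rewrite !inE andbT.
rewrite !{}nE (cardsD1 (fingraph.root e y)) inE roots_root //= add1n; congr _.+1.
rewrite -(@card_in_imset _ _ (fingraph.root G)); last first.
  move=> a b; rewrite !inE => /andP[ay /eqP ra] /andP[by_ /eqP rb] /eqP.
  rewrite root_connect // (connect_del_edge a b gG Gxy) -/e.
  case/or3P => [|/andP[_]|/andP[c _]].
  - by rewrite -root_connect // ra rb => /eqP.
  - by rewrite -root_connect // rb eq_sym (negPf by_).
  - by move: c; rewrite -root_connect // ra (negPf ay).
have sub : subrel (connect e) (connect G) := connect_mono (@del_edge_sub _ G x y).
apply: eq_card => z; rewrite [in RHS]inE; apply/imsetP/idP => [[w _ ->]|/eqP rz].
  exact: roots_root.
have rr w : fingraph.root G (fingraph.root e w) = fingraph.root G w.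
  by apply/eqP; rewrite root_connect // sG sub // connect_root.
have [zy|zy] := eqVneq (fingraph.root e z) (fingraph.root e y); last first.
  by exists (fingraph.root e z); rewrite ?rr // !inE zy roots_root.
(* Here [z] lies in the class of [y], whose root was taken out; the class of [x], merged with it in
   [G], supplies the preimage. *)
exists (fingraph.root e x); rewrite ?rr ?rz.
  by rewrite !inE roots_root // root_connect // ncxy.
rewrite -{1}rz; apply/eqP; rewrite root_connect //.
apply: (@connect_trans _ _ y); first by apply: sub; rewrite -root_connect // zy.
by rewrite sG connect1.
Qed.

Local Open Scope ring_scope.

(** Deleting a bridge loses one edge and gains one component, so only an edge on a cycle contributes
    to [theta]. *)
Lemma theta_del_edge n (G : rel 'I_n) x y : is_graph G -> G x y ->
  theta G = theta (del_edge G x y) + (connect (del_edge G x y) x y : nat)%:Z.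
Proof.
move=> gG Gxy; rewrite /theta (edges_del_edge gG Gxy).
have [c|c] := boolP (connect _ x y).
  by rewrite (ncomp_nonbridge gG Gxy c) /=; lia.
by rewrite (ncomp_bridge gG Gxy c) /=; lia.
Qed.

(** * Monotonicity of the cyclomatic number *)

Lemma eq_edges n (G H : rel 'I_n) : G =2 H -> edges G = edges H.
Proof. by move=> e; apply/setP=> p; rewrite !inE e. Qed.

Lemma eq_theta n (G H : rel 'I_n) : G =2 H -> theta G = theta H.
Proof.
move=> e; rewrite /theta (eq_edges e); congr (_ + Posz _).
by apply: eq_n_comp; apply: eq_connect.
Qed.

Lemma subrel_edges n (G H : rel 'I_n) : is_graph G -> is_graph H ->
  edges G \subset edges H -> subrel G H.
Proof.
move=> [sG iG] [sH _] /subsetP sub x y Gxy.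
have [ltxy|ltyx|/val_inj exy] := ltngtP x y.
- by have := sub (x, y); rewrite !inE /= ltxy Gxy; apply.
- by have := sub (y, x); rewrite !inE /= ltyx sG Gxy sH; apply.
- by rewrite exy iG in Gxy.
Qed.

Lemma edges_sub n (G H : rel 'I_n) : subrel G H -> edges G \subset edges H.
Proof. by move=> s; apply/subsetP=> p; rewrite !inE => /andP[-> /s]. Qed.

Lemma subrel_or_missing n (G H : rel 'I_n) : is_graph G -> is_graph H ->
  subrel H G -> G =2 H \/ exists x y, G x y /\ ~~ H x y.
Proof.
move=> gG gH sub.
have [/(subrel_edges gG gH) s|] := boolP (edges G \subset edges H).
  by left=> x y; apply/idP/idP; [apply: s | apply: sub].
case/subsetPn => -[x y]; rewrite !inE /= => /andP[lt Gxy].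
by rewrite lt /= => nH; right; exists x, y.
Qed.

Lemma sub_del_edge n (G H : rel 'I_n) x y : is_graph H -> subrel H G ->
  ~~ H x y -> subrel H (del_edge G x y).
Proof.
move=> [sH _] sub nH a b Hab; rewrite /del_edge (sub _ _ Hab) /=.
by apply: contra nH => /orP[] /andP[/eqP<- /eqP<-]; rewrite // sH.
Qed.

(** The measure is the number of edges, since deleted vertices stay in the vertex type. *)
Lemma edges_ind n (P : rel 'I_n -> Prop) :
  (forall G, is_graph G ->
    (forall H, is_graph H -> (#|edges H| < #|edges G|)%N -> P H) -> P G) ->
  forall G, is_graph G -> P G.
Proof.
move=> step G; have [m] := ubnP #|edges G|; elim: m G => // m IH G le gG.
by apply: step => // H gH lt; apply: IH => //; apply: leq_trans lt _.
Qed.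

Lemma theta_sub n (G H : rel 'I_n) : is_graph G -> is_graph H -> subrel H G ->
  (theta H <= theta G)%R.
Proof.
move=> + gH; move: G; apply: edges_ind => G gG IH sub.
have [e|[x [y [Gxy nH]]]] := subrel_or_missing gG gH sub.
  by rewrite (eq_theta e).
rewrite (theta_del_edge gG Gxy) ler_wpDr //; apply: IH.
- exact: del_edge_graph.
- by rewrite (edges_del_edge gG Gxy).
- exact: sub_del_edge.
Qed.

(** The missing edges are removed one at a time; a bridge stays a bridge in every subgraph
    containing it, so the hypothesis persists. *)
Lemma theta_bridges n (G H : rel 'I_n) : is_graph G -> is_graph H -> subrel H G ->
  (forall x y, G x y -> ~~ H x y -> ~~ connect (del_edge G x y) x y) ->
  theta H = theta G.
Proof.
move=> + gH; move: G; apply: edges_ind => G gG IH sub br.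
have [e|[x [y [Gxy nH]]]] := subrel_or_missing gG gH sub.
  by rewrite (eq_theta e).
rewrite (theta_del_edge gG Gxy) (negPf (br _ _ Gxy nH)) addr0.
apply: IH; first exact: del_edge_graph.
- by rewrite (edges_del_edge gG Gxy).
- exact: sub_del_edge.
move=> a b /andP[Gab _] nHab; apply: contra (br a b Gab nHab).
by apply: connect_mono => p q /andP[/andP[Gpq _] h]; rewrite /del_edge Gpq.
Qed.

Lemma theta_empty n (G : rel 'I_n) : G =2 (fun _ _ => false) -> theta G = 0.
Proof.
move=> e; rewrite /theta.
have -> : edges G = set0 by apply/setP=> p; rewrite !inE e andbF.
have -> : ncomp G = n; last by rewrite cards0 add0r addNr.
rewrite -[RHS]card_ord; apply: eq_card => z; rewrite !inE andbT /in_mem /=.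
rewrite /roots /fingraph.root; case: pickP => [w /= /connectP[[|a p] /=]|] //.
- by move=> _ ->; rewrite eqxx.
- by rewrite e.
- by rewrite eqxx.
Qed.

Lemma theta_ge0 n (G : rel 'I_n) : is_graph G -> 0 <= theta G.
Proof.
move=> gG; have e := @theta_empty n (fun _ _ => false) (fun _ _ => erefl).
by rewrite -[0]e; apply: theta_sub.
Qed.

(** * Cycles *)

Local Open Scope nat_scope.

Lemma ex_cycleP n (G : rel 'I_n) (P : seq 'I_n -> bool) :
  reflect (exists2 s, is_cyc G s & P s) (ex_cycle G P).
Proof.
apply: (iffP existsP) => [[k /existsP[t /andP[c p]]]|[s c p]]; first by exists t.
have lt : size s < n.+1.
  have /and3P[_ us _] := c; rewrite ltnS -(card_uniqP us).
  by have := max_card (mem s); rewrite card_ord.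
by exists (Ordinal lt); apply/existsP; exists (in_tuple s); rewrite /= c p.
Qed.

Lemma mem_zip_rot n (s : seq 'I_n) a b : uniq s ->
  ((a, b) \in zip s (rot 1 s)) = (a \in s) && (b == next s a).
Proof.
case: s => [//|y p] us.
have sz : size (zip (y :: p) (rcons p y)) = (size p).+1.
  by rewrite size_zip size_rcons minnn.
rewrite rot1_cons next_nth.
apply/idP/andP => [/(nthP (y, y))[i]|[ain /eqP->]].
  rewrite sz ltnS => lei; rewrite nth_zip ?size_rcons // => -[<- <-].
  rewrite mem_nth // index_uniq //; split=> //.
  (* At the last index [nth] falls back on its default [y], the head of the sequence: this is the
     closing edge. *)
  rewrite nth_rcons; case: ltngtP lei => // -> _.
  by rewrite (nth_default _ (leqnn _)).
rewrite ain; apply/(nthP (y, y)); exists (index a (y :: p)).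
  by rewrite sz -[(size p).+1]/(size (y :: p)) index_mem.
rewrite nth_zip ?size_rcons // nth_index //; congr pair.
rewrite nth_rcons; case: ltngtP => // [lt|->]; last by rewrite (nth_default _ (leqnn _)).
by rewrite nth_default // ltnW.
Qed.

Lemma mem_cycle_edges n (s : seq 'I_n) a b : uniq s ->
  ((a, b) \in cycle_edges s) =
  (a \in s) && (b == next s a) || (b \in s) && (a == next s b).
Proof. by move=> us; rewrite inE /= !mem_zip_rot. Qed.

Lemma cycle_edgesC n (s : seq 'I_n) a b :
  ((a, b) \in cycle_edges s) = ((b, a) \in cycle_edges s).
Proof. by rewrite !inE orbC. Qed.

Lemma cycle_edges_mem n (s : seq 'I_n) a b : uniq s ->
  (a, b) \in cycle_edges s -> (a \in s) /\ (b \in s).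
Proof.
by move=> us; rewrite mem_cycle_edges // => /orP[] /andP[h /eqP->]; rewrite mem_next.
Qed.

Lemma next_cycle_edges n (s : seq 'I_n) a : uniq s -> a \in s ->
  (a, next s a) \in cycle_edges s.
Proof. by move=> us ain; rewrite mem_cycle_edges // ain eqxx. Qed.

Lemma cycle_edges_adj n (G : rel 'I_n) s a b : is_graph G -> is_cyc G s ->
  (a, b) \in cycle_edges s -> G a b.
Proof.
move=> gG /and3P[_ us cs]; rewrite mem_cycle_edges //.
by case/orP => /andP[h /eqP->]; [|rewrite gG.1]; apply: next_cycle cs h.
Qed.

Lemma is_cyc_mono n (G H : rel 'I_n) s : is_cyc G s ->
  (forall a b, (a, b) \in cycle_edges s -> H a b) -> is_cyc H s.
Proof.
move=> /and3P[s3 us cs] sub; rewrite /is_cyc s3 us /=.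
by apply: cycle_from_next => // a ain; apply: sub; apply: next_cycle_edges.
Qed.

Lemma vset_cycle_edges n (s : seq 'I_n) : uniq s ->
  vset (cycle_edges s) = [set x in s].
Proof.
move=> us; apply/setP=> x; rewrite !inE; apply/existsP/idP => [[y]|xin].
  by case/(cycle_edges_mem us).
by exists (next s x); apply: next_cycle_edges.
Qed.

Lemma is_cyc_uniq n (G : rel 'I_n) s : is_cyc G s -> uniq s.
Proof. by case/and3P. Qed.

Lemma is_cyc_rot n (G : rel 'I_n) i s : is_cyc G (rot i s) = is_cyc G s.
Proof. by rewrite /is_cyc size_rot rot_uniq rot_cycle. Qed.

Lemma cycle_edges_rot n i (s : seq 'I_n) : uniq s ->
  cycle_edges (rot i s) = cycle_edges s.
Proof.
move=> us; apply/setP => -[a b].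
by rewrite !mem_cycle_edges ?rot_uniq // !mem_rot !next_rot.
Qed.

(** Rotated to start at [a], the cycle reads [a, b, c, ...]; the way from [b] through [c] back to
    [a] avoids the edge [ab]. *)
Lemma cycle_next_connect n (G : rel 'I_n) s a : is_graph G -> is_cyc G s -> a \in s ->
  connect (del_edge G a (next s a)) a (next s a).
Proof.
move=> gG cs ain; have us := is_cyc_uniq cs.
have [i p es] := rot_to ain.
rewrite -(next_rot i us) es; move: (is_cyc_rot G i s); rewrite {}es cs.
case: p => [|b [|c p]] //= /and3P[_ /=]; rewrite eqxx !inE !negb_or.
case/and4P => /and3P[ab ac ap] /andP[bc bp] cp _ /and3P[Gab Gbc pth].
rewrite (graph_connect_sym (del_edge_graph a b gG)).
apply: (@connect_trans _ _ c).
  apply: connect1; rewrite /del_edge Gbc [c == a]eq_sym (negPf ac).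
  by rewrite [c == b]eq_sym (negPf bc) !andbF.
apply/connectP; exists (rcons p a); rewrite ?last_rcons //.
(* Every edge of the path from [c] to [a] starts outside [a] and [b], hence is not the deleted
   one. *)
have : all (fun z => (z != a) && (z != b)) (c :: p).
  rewrite /= eq_sym ac eq_sym bc /=; apply/allP => z zp.
  by apply/andP; split; [apply: contraNneq ap | apply: contraNneq bp] => <-.
elim: p c pth {ac bc cp ap bp Gbc} => [|d p IH] c /= /andP[Gcd pth].
  by case/andP=> /andP[ca cb] _; rewrite /del_edge Gcd (negPf ca) (negPf cb).
case/andP=> /andP[ca cb] al.
by rewrite /del_edge Gcd (negPf ca) (negPf cb) /=; apply: IH.
Qed.

Lemma cycle_edge_connect n (G : rel 'I_n) s a b : is_graph G -> is_cyc G s ->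
  (a, b) \in cycle_edges s -> connect (del_edge G a b) a b.
Proof.
move=> gG cs; rewrite mem_cycle_edges ?(is_cyc_uniq cs) //.
case/orP => /andP[h /eqP->]; first exact: cycle_next_connect.
rewrite (eq_connect (del_edgeC _ _ _)) (graph_connect_sym (del_edge_graph _ _ gG)).
exact: cycle_next_connect.
Qed.

(** A duplicate-free path from [a] to [b] is closed by the edge [ab]. It has at least three
    vertices, because [a != b] and the direct edge is deleted. *)
Lemma nonbridge_cycle n (G : rel 'I_n) a b : is_graph G -> G a b ->
  connect (del_edge G a b) a b ->
  exists2 s, is_cyc G s & (a, b) \in cycle_edges s.
Proof.
move=> gG Gab /connectP[p pth lb]; case/shortenP: pth lb => q pth uq _ lb.
have ab := graph_neq gG Gab.
case: q pth uq lb => [|c [|d q]] pth uq lb.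
- by rewrite lb eqxx in ab.
- by move: pth; rewrite lb /= /del_edge !eqxx andbF.
set s := [:: a, c, d & q] in uq *.
have lin : b \in s by rewrite lb mem_last.
exists s; last first.
  have ib : index b s = size [:: c, d & q].
    have -> : b = nth a s (size [:: c, d & q]) by rewrite lb -nth_last.
    by rewrite index_uniq.
  have nb : next s b = a by rewrite next_nth lin ib /s nth_default.
  by rewrite mem_cycle_edges // lin nb eqxx orbT.
rewrite /is_cyc uq /=.
have: path G a (rcons [:: c, d & q] a).
  rewrite rcons_path -lb gG.1 Gab andbT.
  by apply: sub_path pth; apply: del_edge_sub.
by [].
Qed.

Lemma on_cycleP n (G : rel 'I_n) x :
  reflect (exists2 s, is_cyc G s & x \in s) (on_cycle G x).
Proof. exact: ex_cycleP. Qed.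

Lemma same_nodeP n (G : rel 'I_n) x y :
  reflect (x = y \/ exists s, [/\ is_cyc G s, x \in s & y \in s]) (same_node G x y).
Proof.
rewrite /same_node; apply: (iffP orP).
  case=> [/eqP|/ex_cycleP[s cs /andP[xs ys]]]; first by left.
  by right; exists s.
case=> [->|[s [cs xs ys]]]; first by left.
by right; apply/ex_cycleP; exists s; rewrite ?xs.
Qed.

Lemma cyclesP n (G : rel 'I_n) E :
  reflect (exists2 s, is_cyc G s & cycle_edges s = E) (E \in cycles G).
Proof.
rewrite inE; apply: (iffP (ex_cycleP _ _)) => -[s cs /eqP h]; by exists s.
Qed.

Lemma is_cyc_del n (G : rel 'I_n) (X : {set 'I_n}) s :
  is_cyc G s -> (forall x, x \in s -> x \notin X) ->
  is_cyc (del_vertices X G) s.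
Proof.
move=> cs dis; have /and3P[s3 us cy] := cs; rewrite /is_cyc s3 us /=.
apply: cycle_from_next => // a ain; rewrite /del_vertices.
by rewrite !dis ?mem_next // (next_cycle cy).
Qed.

Lemma is_cyc_sub n (G H : rel 'I_n) s : subrel H G -> is_cyc H s -> is_cyc G s.
Proof.
move=> sub /and3P[s3 us cy]; rewrite /is_cyc s3 us /=.
by apply: sub_cycle cy.
Qed.

Lemma is_cyc_del_notin n (G : rel 'I_n) (X : {set 'I_n}) s x : is_cyc (del_vertices X G) s ->
  x \in s -> x \notin X.
Proof. by move=> /and3P[_ us cy] xs; have /and3P[] := next_cycle cy xs. Qed.

Lemma theta_cycle_missing n (G H : rel 'I_n) s a b : is_graph G -> is_graph H ->
  subrel H G -> is_cyc G s -> (a, b) \in cycle_edges s -> ~~ H a b ->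
  (theta H + 1 <= theta G)%R.
Proof.
move=> gG gH sub cs ce nH; have Gab := cycle_edges_adj gG cs ce.
rewrite (theta_del_edge gG Gab) (cycle_edge_connect gG cs ce).
by rewrite lerD2r theta_sub //; [apply: del_edge_graph | apply: sub_del_edge].
Qed.

Lemma theta_del_cycle_vertex n (G : rel 'I_n) (X : {set 'I_n}) x : is_graph G -> on_cycle G x ->
  x \in X -> (theta (del_vertices X G) + 1 <= theta G)%R.
Proof.
move=> gG /on_cycleP[s cs xs] xX.
apply: (theta_cycle_missing gG _ _ cs (next_cycle_edges (is_cyc_uniq cs) xs)).
- exact: del_vertices_graph.
- exact: del_vertices_sub.
- by rewrite /del_vertices xX.
Qed.

(** Each lost edge has an end in [X], which lies on no cycle, so it is a bridge. *)
Lemma theta_del_acyclic n (G : rel 'I_n) (X : {set 'I_n}) : is_graph G ->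
  (forall x, x \in X -> ~~ on_cycle G x) -> theta (del_vertices X G) = theta G.
Proof.
move=> gG nX; apply: theta_bridges => //.
- exact: del_vertices_graph.
- exact: del_vertices_sub.
move=> x y Gxy; rewrite /del_vertices Gxy andbT -negb_or negbK => xyX.
apply/negP => /(nonbridge_cycle gG Gxy)[s cs ce].
have [xs ys] := cycle_edges_mem (is_cyc_uniq cs) ce.
by case/orP: xyX => /nX/on_cycleP[]; by exists s.
Qed.

(** Removing the edge [xy] of [s1] costs one and leaves [s2] intact; deleting [x] then breaks [s2]
    and costs another. *)
Lemma theta_two_cycles n (G : rel 'I_n) s1 s2 x y : is_graph G ->
  is_cyc G s1 -> is_cyc G s2 -> x \in s2 ->
  (x, y) \in cycle_edges s1 -> (x, y) \notin cycle_edges s2 ->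
  (theta (del_vertices [set x] G) + 2 <= theta G)%R.
Proof.
move=> gG c1 c2 x2 e1 e2; have Gxy := cycle_edges_adj gG c1 e1.
have gH := del_edge_graph x y gG.
have c2' : is_cyc (del_edge G x y) s2.
  apply: (is_cyc_mono c2) => a b ce; rewrite /del_edge (cycle_edges_adj gG c2 ce) /=.
  apply: contra e2 => /orP[] /andP[/eqP<- /eqP<-] //.
  by rewrite cycle_edgesC.
rewrite (theta_del_edge gG Gxy) (cycle_edge_connect gG c1 e1).
have h : (theta (del_vertices [set x] G) + 1 <= theta (del_edge G x y))%R; last by lia.
apply: (theta_cycle_missing gH _ _ c2' (next_cycle_edges (is_cyc_uniq c2) x2)).
- exact: del_vertices_graph.
- apply: sub_del_edge; [exact: del_vertices_graph|exact: del_vertices_sub|].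
  by rewrite /del_vertices !inE eqxx.
- by rewrite /del_vertices !inE eqxx.
Qed.

Definition cycles_disjoint n (G : rel 'I_n) := forall s1 s2, is_cyc G s1 -> is_cyc G s2 ->
  (exists2 x, x \in s1 & x \in s2) -> cycle_edges s1 = cycle_edges s2.

Lemma cycles_disjoint_mem n (G : rel 'I_n) s1 s2 x : cycles_disjoint G ->
  is_cyc G s1 -> is_cyc G s2 -> x \in s1 -> x \in s2 -> s1 =i s2.
Proof.
move=> dis c1 c2 x1 x2 y; have e : cycle_edges s1 = cycle_edges s2 by apply: dis => //; exists x.
have := vset_cycle_edges (is_cyc_uniq c1); rewrite e (vset_cycle_edges (is_cyc_uniq c2)).
by move/setP/(_ y); rewrite !inE.
Qed.

(* Cycles that agree locally at every common vertex coincide once they meet, since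
   their common vertices are then closed under [next]. *)
Lemma disjoint_of_theta n (G : rel 'I_n) : is_graph G ->
  (forall x, (theta G < theta (del_vertices [set x] G) + 2)%R) -> cycles_disjoint G.
Proof.
move=> gG th.
have loc s1 s2 : is_cyc G s1 -> is_cyc G s2 ->
    (exists2 x, x \in s1 & x \in s2) -> cycle_edges s1 \subset cycle_edges s2.
  move=> c1 c2 [x x1 x2]; have u1 := is_cyc_uniq c1; have u2 := is_cyc_uniq c2.
  have step y z : y \in s2 -> (y, z) \in cycle_edges s1 -> (y, z) \in cycle_edges s2.
    move=> y2 e1; apply/negPn/negP => e2; have := theta_two_cycles gG c1 c2 y2 e1 e2.
    by rewrite leNgt th.
  have sub : {subset s1 <= s2}.
    move=> y y1; have := connect_cycle (cycle_next u1) x1 y1.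
    move: y {y1}; suff h : forall y, connect (frel (next s1)) x y ->
      (y \in s1) /\ (y \in s2) by move=> y /h[].
    apply: connect_ind => // a b _ [a1 a2] /eqP<-; rewrite mem_next; split=> //.
    by have [] := cycle_edges_mem u2 (step _ _ a2 (next_cycle_edges u1 a1)).
  apply/subsetP => -[a b] e1; apply: step => //.
  by apply: sub; have [] := cycle_edges_mem u1 e1.
move=> s1 s2 c1 c2 [x x1 x2]; apply/eqP; rewrite eqEsubset.
by rewrite !loc //; exists x.
Qed.

(** * Bridges with a minimal side *)

Definition bridge n (G : rel 'I_n) (u v : 'I_n) :=
  G u v && ~~ connect (del_edge G u v) u v.

Definition side n (G : rel 'I_n) (u v : 'I_n) : {set 'I_n} :=
  [set z | connect (del_edge G u v) v z].

Lemma bridgeC n (G : rel 'I_n) u v : is_graph G -> bridge G u v = bridge G v u.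
Proof.
move=> gG; rewrite /bridge gG.1 (eq_connect (del_edgeC G u v)).
by rewrite (graph_connect_sym (del_edge_graph v u gG)).
Qed.

Lemma side_edge n (G : rel 'I_n) u v a b : a \in side G u v ->
  del_edge G u v a b -> b \in side G u v.
Proof. by rewrite !inE => c e; apply: connect_trans c (connect1 e). Qed.

(** What [b] reaches without [ab] never includes [v], so it is reached without the edge [uv] too and
    stays on the side of [v]. The inclusion is strict because [v] itself is missed. *)
Lemma side_proper n (G : rel 'I_n) u v a b : is_graph G ->
  b \in side G u v -> ~~ connect (del_edge G a b) b v ->
  side G a b \proper side G u v.
Proof.
move=> gG bS nc; rewrite properE; apply/andP; split; last first.
  by apply/subsetPn; exists v; rewrite inE ?connect0.
apply/subsetP => z; rewrite inE; move: z; apply: connect_ind => // y z cy yS e.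
apply: side_edge yS _; rewrite /del_edge (del_edge_sub e) /=.
have nv w : connect (del_edge G a b) b w -> w != v by apply: contraTneq => ->.
have cz := connect_trans cy (connect1 e).
by rewrite (negPf (nv _ cy)) (negPf (nv _ cz)) andbF.
Qed.

(** Descent on the size of the side: a bridge inside it, suitably oriented, has a strictly smaller
    side. *)
Lemma innermost_bridge n (G : rel 'I_n) u0 v0 : is_graph G -> bridge G u0 v0 ->
  exists u v, [/\ bridge G u v, side G u v \subset side G u0 v0 &
    forall a b, a \in side G u v -> b \in side G u v -> ~~ bridge G a b].
Proof.
move=> gG; have [m] := ubnP #|side G u0 v0|; elim: m u0 v0 => // m IH u0 v0 le br.
case: (boolP [exists a, exists b,
  [&& a \in side G u0 v0, b \in side G u0 v0 & bridge G a b]]); last first.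
  rewrite negb_exists => /forallP h; exists u0, v0; split=> // a b aS bS.
  by have := h a; rewrite negb_exists => /forallP/(_ b); rewrite aS bS.
case/existsP => a /existsP[b /and3P[aS bS brab]].
(* Without the bridge [ab] at most one of its ends still reaches [v0]; the ends are swapped if that
   one is [b]. *)
wlog nc : a b aS bS brab / ~~ connect (del_edge G a b) b v0.
  move=> hw; case: (boolP (connect (del_edge G a b) b v0)) => [c|]; last exact: hw.
  apply: (hw b a) => //; first by rewrite bridgeC.
  rewrite (eq_connect (del_edgeC G b a)).
  have ce := graph_connect_sym (del_edge_graph a b gG).
  case/andP: brab => _; apply: contra => c'; apply: connect_trans c' _.
  by rewrite ce.
have pr := side_proper gG bS nc.
have [|//|u [v [buv sub h]]] := IH a b; first exact: leq_trans (proper_card pr) _.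
by exists u, v; split=> //; apply: subset_trans sub (proper_sub pr).
Qed.

Lemma bridge_notin_cycle n (G : rel 'I_n) u v s : is_graph G -> bridge G u v ->
  is_cyc G s -> is_cyc (del_edge G u v) s.
Proof.
move=> gG /andP[Guv nc] cs; apply: (is_cyc_mono cs) => a b ce.
rewrite /del_edge (cycle_edges_adj gG cs ce) /=; apply: contra nc.
move=> h; apply: (cycle_edge_connect gG cs).
by case/orP: h ce => /andP[/eqP-> /eqP->]; rewrite // cycle_edgesC.
Qed.

Lemma cycle_of_nonbridge n (G : rel 'I_n) a b : is_graph G -> G a b ->
  ~~ bridge G a b -> exists2 s, is_cyc G s & (a, b) \in cycle_edges s.
Proof.
by move=> gG Gab; rewrite /bridge Gab negbK; apply: nonbridge_cycle.
Qed.

(** Inside an innermost side every edge lies on a cycle. If [v] has a second neighbour, it therefore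
    lies on a cycle [s]; any edge at [s] other than [vu] lies on a cycle meeting [s], which is [s]
    by disjointness. *)
Lemma innermost_side n (G : rel 'I_n) u0 v0 : is_graph G -> cycles_disjoint G ->
  bridge G u0 v0 ->
  exists u v, [/\ G u v, v \in side G u0 v0 &
    (forall z, G v z -> z = u) \/
    exists s, [/\ is_cyc G s, v \in s, u \notin s &
      forall a b, a \in s -> G a b ->
        (a, b) \in cycle_edges s \/ (a = v /\ b = u)]].
Proof.
move=> gG dis /(innermost_bridge gG)[u [v [br sub inner]]].
have /andP[Guv nc] := br.
have vS : v \in side G u v by rewrite inE connect0.
have uS : u \notin side G u v.
  by rewrite inE (graph_connect_sym (del_edge_graph u v gG)).
exists u, v; split=> //; first exact: (subsetP sub).
case: (boolP [exists w, G v w && (w != u)]); last first.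
  rewrite negb_exists => /forallP h; left=> z Gvz; apply/eqP.
  by have := h z; rewrite Gvz /= negbK.
case/existsP => w /andP[Gvw wu]; right.
have uv := graph_neq gG Guv.
have evw : del_edge G u v v w.
  by rewrite /del_edge Gvw [v == u]eq_sym (negPf uv) (negPf wu) andbF.
have wS := side_edge vS evw.
have [s cs ce] := cycle_of_nonbridge gG Gvw (inner _ _ vS wS).
have us := is_cyc_uniq cs; have [vs ws] := cycle_edges_mem us ce.
have sS z : z \in s -> z \in side G u v.
  have /and3P[_ _ cy] := bridge_notin_cycle gG br cs.
  by move=> zs; rewrite inE; apply: (connect_cycle cy).
have nus : u \notin s by apply: contra uS => /sS.
exists s; split=> // a b as_ Gab.
case: (boolP (del_edge G u v a b)) => [e|]; last first.
  rewrite /del_edge Gab /= negbK => /orP[] /andP[/eqP ea /eqP eb]; last by right.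
  by rewrite -ea as_ in nus.
left; have [t ct cet] := cycle_of_nonbridge gG Gab (inner _ _ (sS _ as_) (side_edge (sS _ as_) e)).
have [at_ _] := cycle_edges_mem (is_cyc_uniq ct) cet.
by rewrite -(dis t s) //; exists a.
Qed.

(** * Rank and the lower bound *)

Local Open Scope ring_scope.

(** Row [v] is a multiple of a unit row [d]; subtracting multiples of [d] from the other rows clears
    column [u], and the row space becomes a direct sum with the line of [d]. *)
Lemma rank_elim_row (F : fieldType) n (B : 'M[F]_n) (v u : 'I_n) (c : F) : c != 0 ->
  (forall j, B v j = c *+ (j == u)) ->
  \rank B = (\rank (\matrix_(i, j) (if (i == v) || (j == u) then 0 else B i j))).+1.
Proof.
move=> c0 rv; set B1 := \matrix_(i, j) _.
pose d : 'rV[F]_n := delta_mx 0 u.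
have dB : (d <= B)%MS.
  have -> : d = c^-1 *: row v B.
    by apply/rowP=> j; rewrite !mxE rv mulrnAr mulVf // eqxx.
  by rewrite scalemx_sub ?row_sub.
have colu (w : 'rV[F]_n) : w 0 u *: d = \row_j (w 0 u *+ (j == u)).
  by apply/rowP=> j; rewrite !mxE eqxx mulr_natr.
have e1 i : i != v -> row i B1 = row i B - (row i B) 0 u *: d.
  move=> iv; rewrite colu; apply/rowP=> j; rewrite !mxE (negPf iv) /=.
  by case: eqP => [->|_]; rewrite ?subrr ?subr0.
have eqB : (B :=: B1 + d)%MS.
  apply/eqmxP/andP; split; last first.
    rewrite addsmx_sub dB andbT; apply/row_subP => i.
    have [->|iv] := eqVneq i v.
      by rewrite (_ : row v B1 = 0) ?sub0mx //; apply/rowP=> j; rewrite !mxE eqxx.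
    by rewrite e1 // addmx_sub ?row_sub // -scaleNr scalemx_sub.
  apply/row_subP => i; have [->|iv] := eqVneq i v.
    apply: submx_trans (addsmxSr _ _).
    rewrite (_ : row v B = c *: d) ?scalemx_sub //.
    by apply/rowP=> j; rewrite !mxE eqxx rv mulr_natr.
  rewrite -[row i B](subrK ((row i B) 0 u *: d)) -e1 // addmx_sub_adds ?row_sub //.
  by rewrite scalemx_sub.
rewrite eqB mxrank_disjoint_sum; first by rewrite mxrank_delta addn1.
apply/eqP; rewrite -submx0; apply/rV_subP => w; rewrite sub_capmx => /andP[w1 w2].
have /sub_rVP[a wa] := w2; case/submxP: w1 => D wD.
(* Column [u] of [B1] vanishes, whereas a nonzero multiple of [d] has a nonzero entry there. *)
have : w 0 u = 0 by rewrite wD mxE big1 // => k _; rewrite !mxE eqxx orbT mulr0.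
by rewrite wa !mxE !eqxx mulr1 => ->; rewrite scale0r sub0mx.
Qed.

Lemma eq_rank_gain (C : numClosedFieldType) n (G H : rel 'I_n) (phi : 'I_n -> 'I_n -> C) :
  G =2 H -> rank_gain G phi = rank_gain H phi.
Proof.
by move=> e; congr (\rank _); apply/matrixP=> i j; rewrite !mxE e.
Qed.

Lemma unit_gain_neq0 (C : numClosedFieldType) n (G : rel 'I_n) (phi : 'I_n -> 'I_n -> C) i j :
  unit_gain G phi -> G i j -> phi i j != 0.
Proof. by move=> ug /ug[n1 _]; rewrite -normr_eq0 n1 oner_eq0. Qed.

(** Row [v] has its only nonzero entry at [u], and so has column [v]: one elimination on the matrix
    and one on its transpose clear both rows and both columns. *)
Lemma rank_pendant (C : numClosedFieldType) n (G : rel 'I_n) (phi : 'I_n -> 'I_n -> C) v u :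
  is_graph G -> unit_gain G phi -> G v u -> (forall z, G v z -> z = u) ->
  rank_gain G phi = (rank_gain (del_vertices [set u; v] G) phi).+2.
Proof.
move=> gG ug Gvu pend.
have Guv : G u v by rewrite gG.1.
have vu := graph_neq gG Gvu.
have Gv j : G v j = (j == u) by apply/idP/eqP => [/pend|->].
rewrite /rank_gain (@rank_elim_row _ _ _ v u (phi v u)); first last.
- by move=> j; rewrite mxE Gv; case: eqP => [->|_].
- exact: (unit_gain_neq0 ug).
rewrite -mxrank_tr (@rank_elim_row _ _ _ v u (phi u v)); first last.
- move=> j; rewrite !mxE (negPf vu) orbF gG.1 Gv.
  by case: (j =P u) => [->|_]; rewrite ?(negPf vu) 1?eq_sym ?(negPf vu) //; case: eqP.
- exact: (unit_gain_neq0 ug).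
rewrite -mxrank_tr; congr (\rank _).+2; apply/matrixP=> i j; rewrite !mxE.
rewrite /del_vertices !inE.
by case: (i =P u); case: (i =P v); case: (j =P u); case: (j =P v) => //=; case: (G i j).
Qed.

Lemma rank_del_vertices_le (C : numClosedFieldType) n (G : rel 'I_n)
  (phi : 'I_n -> 'I_n -> C) (X : {set 'I_n}) :
  (rank_gain (del_vertices X G) phi <= rank_gain G phi)%N.
Proof.
(* The diagonal projection onto the vertices outside [X], applied on both sides. *)
pose D : 'M[C]_n := \matrix_(i, j) ((i == j) && (i \notin X))%:R.
have -> : rank_gain (del_vertices X G) phi = \rank (D *m gain_adj G phi *m D).
  congr (\rank _); apply/matrixP=> i j; rewrite mxE [RHS]mxE (bigD1 j) //= big1 => [|k kj].
    rewrite addr0 !mxE eqxx /= (bigD1 i) //= big1 => [|k ki]; last first.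
      by rewrite !mxE eq_sym (negPf ki) mul0r.
    rewrite !mxE eqxx /= addr0 /del_vertices.
    by case: (i \in X); case: (j \in X); rewrite /= ?mulr0 ?mul0r ?mul1r ?mulr1.
  by rewrite !mxE (negPf kj) mulr0.
exact: leq_trans (mxrankM_maxl _ _) (mxrankM_maxr _ _).
Qed.

Lemma rank_del_vertex_ge (C : numClosedFieldType) n (G : rel 'I_n)
  (phi : 'I_n -> 'I_n -> C) x :
  (rank_gain G phi <= rank_gain (del_vertices [set x] G) phi + 2)%N.
Proof.
pose A := gain_adj G phi.
pose e : 'rV[C]_n := delta_mx 0 x.
(* Row [x] and column [x] are restored by two terms of rank at most one; [A'] has row [x] cleared so
   that the entry where they cross is counted once. *)
pose A' := \matrix_(i, j) (if i == x then 0 else A i j).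
have -> : rank_gain G phi = \rank (gain_adj (del_vertices [set x] G) phi
    + (e^T *m row x A + col x A' *m e))%R.
  congr (\rank _); apply/matrixP=> i j; rewrite !mxE !big_ord1 !mxE !eqxx /=.
  rewrite /del_vertices !inE.
  by case: (i =P x) => [->|_]; case: (j =P x) => [->|_]; rewrite /= ?add0r ?mul1r
    ?mulr1 ?mul0r ?mulr0 ?addr0 ?add0r.
apply: leq_trans (mxrank_add _ _) _; rewrite leq_add2l.
apply: leq_trans (mxrank_add _ _) _; rewrite -[2%N]/(1 + 1)%N.
apply: leq_add; apply: leq_trans (mxrankM_maxl _ _) _; exact: rank_leq_col.
Qed.

(** * The bound [r(Phi) >= r(G) - 2 theta(G)] *)

Lemma rank_graphE (C : numClosedFieldType) n (G : rel 'I_n) :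
  rank_graph C G = rank_gain G (fun _ _ => 1 : C).
Proof. by congr (\rank _); apply/matrixP=> i j; rewrite !mxE; case: (G i j). Qed.

Lemma unit_gain1 (C : numClosedFieldType) n (G : rel 'I_n) : unit_gain G (fun _ _ => 1 : C).
Proof. by move=> i j _; rewrite normr1 rmorph1. Qed.

Lemma unit_gain_sub (C : numClosedFieldType) n (G H : rel 'I_n) (phi : 'I_n -> 'I_n -> C) :
  subrel H G -> unit_gain G phi -> unit_gain H phi.
Proof. by move=> sub ug i j /sub; apply: ug. Qed.

Lemma rank_empty (C : numClosedFieldType) n (G : rel 'I_n) (phi : 'I_n -> 'I_n -> C) :
  G =2 (fun _ _ => false) -> rank_gain G phi = 0%N.
Proof.
move=> e; rewrite (eq_rank_gain _ e) /rank_gain (_ : gain_adj _ _ = 0) ?mxrank0 //.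
by apply/matrixP=> i j; rewrite !mxE.
Qed.

Lemma edges_del_lt n (G : rel 'I_n) (X : {set 'I_n}) x y : is_graph G ->
  G x y -> x \in X -> (#|edges (del_vertices X G)| < #|edges G|)%N.
Proof.
move=> gG Gxy xX; rewrite (edges_del_edge gG Gxy) ltnS; apply: subset_leq_card.
apply: edges_sub; apply: sub_del_edge; [exact: del_vertices_graph|exact: del_vertices_sub|].
by rewrite /del_vertices xX.
Qed.

Lemma empty_or_edge n (G : rel 'I_n) :
  G =2 (fun _ _ => false) \/ exists x y, G x y.
Proof.
case: (boolP [exists x, exists y, G x y]) => [/existsP[x /existsP[y h]]|].
  by right; exists x, y.
rewrite negb_exists => /forallP h; left=> x y; apply/negbTE.
by have := h x; rewrite negb_exists => /forallP.
Qed.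

(** Every edge is a bridge and there is no cycle to cut off, so [innermost_side] yields a pendant
    vertex; removing it with its neighbour lowers both ranks by 2. *)
Lemma rank_acyclic (C : numClosedFieldType) n (G : rel 'I_n) (phi : 'I_n -> 'I_n -> C) :
  is_graph G -> unit_gain G phi -> (forall s, ~~ is_cyc G s) ->
  rank_gain G phi = rank_graph C G.
Proof.
rewrite rank_graphE; move: G; apply: edges_ind => G gG IH ug ac.
have [e|[x [y Gxy]]] := empty_or_edge G; first by rewrite !rank_empty.
have br : bridge G x y.
  apply/negPn/negP => /(cycle_of_nonbridge gG Gxy)[s cs].
  by rewrite (negPf (ac s)) in cs.
have [|u [v [Guv _ [pend|[s []]]]]] := innermost_side gG _ br.
- by move=> s1 s2 c1; rewrite (negPf (ac s1)) in c1.
- have Gvu : G v u by rewrite gG.1.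
  rewrite (rank_pendant gG ug Gvu pend) (rank_pendant gG (@unit_gain1 _ _ _) Gvu pend).
  congr _.+2; apply: IH.
  + exact: del_vertices_graph.
  + by apply: edges_del_lt Guv _; rewrite // !inE eqxx.
  + exact: unit_gain_sub (@del_vertices_sub _ _ _) ug.
  + by move=> s; apply: contra (ac s); apply: is_cyc_sub (@del_vertices_sub _ _ _).
- by rewrite (negPf (ac s)).
Qed.

Lemma rank_gain_ge (C : numClosedFieldType) n (G : rel 'I_n) (phi : 'I_n -> 'I_n -> C) :
  is_graph G -> unit_gain G phi ->
  (rank_graph C G)%:Z - 2 * theta G <= (rank_gain G phi)%:Z.
Proof.
move: G; apply: edges_ind => G gG IH ug.
have [/existsP[x ox]|] := boolP [exists x, on_cycle G x]; last first.
  rewrite negb_exists => /forallP nc; rewrite (rank_acyclic gG ug).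
    by have := theta_ge0 gG; lia.
  move=> s; apply/negP => cs; case: s cs => [//|x s] cs.
  by case/on_cycleP: (nc x); exists (x :: s); rewrite ?mem_head.
have xx : x \in [set x] by rewrite inE.
have lt : (#|edges (del_vertices [set x] G)| < #|edges G|)%N.
  have /on_cycleP[s /and3P[_ _ cs] xs] := ox.
  exact: edges_del_lt (next_cycle cs xs) xx.
have := IH _ (del_vertices_graph _ gG) lt (unit_gain_sub (@del_vertices_sub _ _ _) ug).
have := theta_del_cycle_vertex gG ox xx.
have := rank_del_vertex_ge G (fun _ _ => 1 : C) x.
have := rank_del_vertices_le G phi [set x].
rewrite !rank_graphE.
move: (theta _) (theta _) (rank_gain _ _) (rank_gain _ _) (rank_gain _ _) (rank_gain _ _).
by lia.
Qed.

(** * The equality case *)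

(** The equality is bundled with the graph and gain conditions so that a single invariant passes
    through the inductions. *)
Definition tight (C : numClosedFieldType) n (phi : 'I_n -> 'I_n -> C) (G : rel 'I_n) :=
  [/\ is_graph G, unit_gain G phi &
      (rank_gain G phi)%:Z = (rank_graph C G)%:Z - 2 * theta G].

Lemma eq_tight (C : numClosedFieldType) n (phi : 'I_n -> 'I_n -> C) (G H : rel 'I_n) :
  G =2 H -> tight phi G -> tight phi H.
Proof.
move=> e [[sG iG] ug t]; split; first by split=> [x y|x]; rewrite -!e.
  by move=> x y; rewrite -e; apply: ug.
by rewrite -(eq_rank_gain _ e) -(eq_theta e) rank_graphE -(eq_rank_gain _ e) -rank_graphE.
Qed.

(** With [H = G - x], the chain [r(Phi) >= r(Phi - x) >= r(H) - 2 theta(H) >= (r(G) - 2) - 2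
    (theta(G) - 1) = r(Phi)] forces equality everywhere. *)
Lemma tight_del_cycle_vertex (C : numClosedFieldType) n (phi : 'I_n -> 'I_n -> C)
  (G : rel 'I_n) x : tight phi G -> on_cycle G x ->
  [/\ tight phi (del_vertices [set x] G),
      rank_graph C G = (rank_graph C (del_vertices [set x] G)).+2 &
      theta G = theta (del_vertices [set x] G) + 1].
Proof.
move=> [gG ug t] ox; have xx : x \in [set x] by rewrite inE.
have gH := del_vertices_graph [set x] gG.
have uH := unit_gain_sub (@del_vertices_sub _ [set x] G) ug.
have := theta_del_cycle_vertex gG ox xx.
have := rank_del_vertex_ge G (fun _ _ => 1 : C) x.
have := rank_del_vertices_le G phi [set x].
have := rank_gain_ge gH uH; move: t; rewrite /tight -!rank_graphE.
move: (theta _) (theta _) (rank_gain _ _) (rank_gain _ _) (rank_graph _ _) (rank_graph _ _).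
by move=> *; split; [split=> // |..]; lia.
Qed.

(** Deleting a vertex lowers [theta] by exactly 1 on a cycle and by 0 elsewhere, hence never by
    2. *)
Lemma tight_disjoint (C : numClosedFieldType) n (phi : 'I_n -> 'I_n -> C)
  (G : rel 'I_n) : tight phi G -> cycles_disjoint G.
Proof.
move=> t; have [gG _ _] := t; apply: disjoint_of_theta => // x.
have [ox|nox] := boolP (on_cycle G x).
  by have [_ _ ->] := tight_del_cycle_vertex t ox; rewrite ltrD2l.
rewrite theta_del_acyclic //; first by rewrite ltrDl.
by move=> y; rewrite inE => /eqP->.
Qed.

(** A cycle edge is not a bridge, but the only edge at [v] is one. *)
Lemma pendant_not_on_cycle n (G : rel 'I_n) v u : is_graph G ->
  (forall z, G v z -> z = u) -> ~~ on_cycle G v.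
Proof.
move=> gG pend; apply/negP => /on_cycleP[s cs vs]; have /and3P[_ _ cy] := cs.
have Gn := next_cycle cy vs; have := cycle_next_connect gG cs vs.
have nv := graph_neq gG Gn; rewrite (pend _ Gn) in nv *.
case/connectP => -[|a p] /=; first by move=> _ e; rewrite e eqxx in nv.
by case/andP => /andP[Gva]; rewrite (pend _ Gva) !eqxx.
Qed.

(* Deleting a pendant edge lowers both ranks by 2, so by [rank_gain_ge] it must
   not lower [theta]. *)
Lemma tight_del_pendant (C : numClosedFieldType) n (phi : 'I_n -> 'I_n -> C)
  (G : rel 'I_n) v u : tight phi G -> G v u -> (forall z, G v z -> z = u) ->
  [/\ tight phi (del_vertices [set u; v] G),
      rank_graph C G = (rank_graph C (del_vertices [set u; v] G)).+2,
      ~~ on_cycle G u & ~~ on_cycle G v].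
Proof.
move=> [gG ug t] Gvu pend; have nv := pendant_not_on_cycle gG pend.
have gH := del_vertices_graph [set u; v] gG.
have uH := unit_gain_sub (@del_vertices_sub _ [set u; v] G) ug.
have r1 := rank_pendant gG (@unit_gain1 C _ G) Gvu pend.
have r2 := rank_pendant gG ug Gvu pend.
have le := rank_gain_ge gH uH.
rewrite -!rank_graphE in r1.
have nu : ~~ on_cycle G u.
  apply/negP => ou; have ux : u \in [set u; v] by rewrite !inE eqxx.
  have := theta_del_cycle_vertex gG ou ux; move: t le r1 r2.
  move: (theta _) (theta _) (rank_gain _ _) (rank_gain _ _) (rank_graph _ _) (rank_graph _ _).
  by lia.
have th : theta (del_vertices [set u; v] G) = theta G.
  by apply: theta_del_acyclic => // x; rewrite !inE => /orP[] /eqP->.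
split=> [||//|//]; last exact: r1.
by split=> [//|//|]; rewrite th; move: t r1 r2;
  move: (theta _) (rank_gain _ _) (rank_gain _ _) (rank_graph _ _) (rank_graph _ _); lia.
Qed.

(** The list is read in pairs [a, b]: once the earlier pairs are deleted, [a] is pendant at [b].
    Each pair then accounts for rank 2; odd lengths are rejected. *)
Fixpoint peelable n (G : rel 'I_n) (q : seq 'I_n) : Prop :=
  if q is a :: q1 then
    if q1 is b :: q2 then
      [/\ G a b, forall z, G a z -> z = b & peelable (del_vertices [set b; a] G) q2]
    else False
  else True.

Lemma seq_pair_ind (T : Type) (P : seq T -> Prop) : P [::] -> (forall a, P [:: a]) ->
  (forall a b q, P q -> P [:: a, b & q]) -> forall q, P q.
Proof.
move=> P0 P1 P2 q; suff [] : P q /\ forall a, P (a :: q) by [].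
by elim: q => [|a q [IH1 IH2]]; split=> // b; apply: P2.
Qed.

Lemma del_peel n (G : rel 'I_n) a b (q : seq 'I_n) :
  del_vertices [set x in q] (del_vertices [set b; a] G)
  =2 del_vertices [set x in [:: a, b & q]] G.
Proof.
move=> x y; rewrite del_verticesU.
suff -> : [set x in q] :|: [set b; a] = [set x in [:: a, b & q]] by [].
by apply/setP=> z; rewrite !inE orbC [(z == b) || _]orbC orbA.
Qed.

Lemma del_none n (G : rel 'I_n) : del_vertices [set x in [::]] G =2 G.
Proof. by move=> x y; rewrite /del_vertices !inE. Qed.

Lemma rank_peel (C : numClosedFieldType) n (phi : 'I_n -> 'I_n -> C) q (G : rel 'I_n) :
  is_graph G -> unit_gain G phi -> peelable G q ->
  rank_gain G phi = (size q + rank_gain (del_vertices [set x in q] G) phi)%N.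
Proof.
elim/seq_pair_ind: q G => [|//|a b q IH] G gG ug /=.
  by rewrite (eq_rank_gain _ (@del_none _ G)).
case=> Gab pend pq; rewrite (rank_pendant gG ug Gab pend) (IH _ _ _ pq).
- by rewrite (eq_rank_gain _ (del_peel G a b q)).
- exact: del_vertices_graph.
- exact: unit_gain_sub (@del_vertices_sub _ _ _) ug.
Qed.

Lemma tight_peel (C : numClosedFieldType) n (phi : 'I_n -> 'I_n -> C) q (G : rel 'I_n) :
  tight phi G -> peelable G q -> tight phi (del_vertices [set x in q] G).
Proof.
elim/seq_pair_ind: q G => [|a|a b q IH] G t; [move=> _ | by case |].
  by apply: eq_tight t => x y; rewrite del_none.
case=> Gab pend pq; have [t' _ _ _] := tight_del_pendant t Gab pend.
exact: eq_tight (del_peel G a b q) (IH _ t' pq).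
Qed.

(** The first vertex of the path is pendant, and stays so after each pair. The last vertex may have
    further neighbours: the length being even, it is always removed as the second of a pair. *)
Lemma path_peelable n (x0 : 'I_n) q (G : rel 'I_n) : ~~ odd (size q) -> uniq q ->
  sorted G q ->
  (forall i z, (i.+1 < size q)%N -> G (nth x0 q i) z ->
     z = nth x0 q i.+1 \/ (0 < i)%N /\ z = nth x0 q i.-1) ->
  peelable G q.
Proof.
elim/seq_pair_ind: q G => [|//|a b q IH] G //= ev /and3P[ab bq uq] /andP[Gab pth] nb.
split=> // [z Gaz|]; first by have [|[]] := nb 0%N z isT Gaz.
move: ab; rewrite inE negb_or => /andP[ab aq].
have out x : x \in q -> x \notin [set b; a].
  by move=> xq; rewrite !inE; apply/norP; split; apply: contraTneq xq => ->.
apply: IH => //; first by move: ev; rewrite negbK.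
- have: sorted G q by apply: path_sorted pth.
  case: q out {bq uq pth nb ev aq} => //= c q out; elim: q c out => //= d q IH c out.
  case/andP=> Gcd pth; rewrite /del_vertices Gcd !out ?inE ?eqxx ?orbT //=.
  by apply: IH => // x xq; apply: out; rewrite inE xq orbT.
- move=> i z lt /and3P[_ zn Gz].
  (* Positions in [q] are shifted by two. For [i = 0] the backward neighbour is [b], already
     deleted. *)
  have [|->|[_ ez]] := nb i.+2 z _ Gz; [by [] | by left |].
  case: i ez {lt Gz} => [|i] /= ez; last by right.
  by rewrite ez !inE eqxx in zn.
Qed.

Lemma next_nth_head n (v : 'I_n) t i : uniq (v :: t) -> (i < size (v :: t))%N ->
  next (v :: t) (nth v (v :: t) i) = nth v (v :: t) i.+1.
Proof. by move=> us lt; rewrite next_nth mem_nth // index_uniq. Qed.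

(* [nth] with default [v] at index [size (v :: t)] closes the cycle. *)
Lemma cycle_edges_nth n (v : 'I_n) t i z : uniq (v :: t) -> (0 < i < size (v :: t))%N ->
  (nth v (v :: t) i, z) \in cycle_edges (v :: t) ->
  z = nth v (v :: t) i.+1 \/ z = nth v (v :: t) i.-1.
Proof.
move=> us /andP[i0 lt]; rewrite mem_cycle_edges //.
case/orP => /andP[h /eqP e]; first by left; rewrite e next_nth_head.
right; have zE : z = nth v (v :: t) (index z (v :: t)) by rewrite nth_index.
have zlt : (index z (v :: t) < size (v :: t))%N by rewrite index_mem.
move: e; rewrite [X in next _ X]zE next_nth_head //.
have [le|gt] := ltnP (index z (v :: t)).+1 (size (v :: t)).
  by move/eqP; rewrite nth_uniq // => /eqP->; rewrite /= nth_index.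
rewrite (nth_default v gt) => /eqP; rewrite -[X in _ == X]/(nth v (v :: t) 0).
by rewrite nth_uniq // => /eqP i00; rewrite i00 in i0.
Qed.

(** Deleting the vertex before position [j] opens the cycle into a path from [j] on. Since [j > 0],
    this path avoids [v], the only vertex allowed to have edges off the cycle. *)
Lemma cycle_peelable n (G : rel 'I_n) v t j k : is_graph G -> is_cyc G (v :: t) ->
  (forall a b, a \in v :: t -> a != v -> G a b -> (a, b) \in cycle_edges (v :: t)) ->
  (0 < j)%N -> ~~ odd (size (take k (drop j (v :: t)))) ->
  peelable (del_vertices [set nth v (v :: t) j.-1] G) (take k (drop j (v :: t))).
Proof.
move=> gG cs nb j0 ev; set s := v :: t in cs nb ev *.
have /and3P[_ us cy] := cs.
have udrop : uniq (drop j s) by apply: drop_uniq.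
pose r := take k (drop j s).
have lts i : (i < size r)%N -> (j + i < size s)%N.
  move=> lt; rewrite -ltn_subRL; apply: leq_trans lt _.
  by rewrite size_take size_drop; case: (ltnP k) => // /ltnW.
have nthr i : (i < size r)%N -> nth v r i = nth v s (j + i).
  move=> lt; rewrite nth_take ?nth_drop //; move: lt.
  by rewrite size_take; case: (ltnP k) => // le lt; apply: leq_trans lt le.
have notin z : z \in r -> z != nth v s j.-1.
  case/(nthP v) => i lt <-; rewrite nthr // nth_uniq ?lts //.
    by rewrite neq_ltn orbC -(ltn_predK j0) /= addSn ltnS leq_addr.
  by apply: leq_ltn_trans (lts _ lt); rewrite (leq_trans (leq_pred _)) ?leq_addr.
rewrite -/r; apply: (@path_peelable _ v) => //; first exact: take_uniq.
- have: sorted G r.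
    apply: take_sorted; apply: drop_sorted.
    by move: cy; rewrite /s /= rcons_path => /andP[].
  move: notin; case: (r) => //= c q; elim: q c => //= d q IH c out.
  case/andP=> Gcd pth; rewrite /del_vertices Gcd !inE !out ?inE ?eqxx ?orbT //=.
  by apply: IH => // x xq; apply: out; rewrite inE xq orbT.
- move=> i z lt /and3P[_]; rewrite inE nthr ?(ltnW lt) // => zn Gz.
  have lt' : (0 < j + i < size s)%N by rewrite lts ?(ltnW lt) // addn_gt0 j0.
  have ji : nth v s (j + i) != v.
    by rewrite -[X in _ != X]/(nth v s 0) nth_uniq ?lts ?(ltnW lt) // -lt0n addn_gt0 j0.
  have sin : nth v s (j + i) \in s by rewrite mem_nth ?lts ?(ltnW lt).
  have [->|ez] := cycle_edges_nth us lt' (nb _ _ sin ji Gz); first by left; rewrite nthr ?addnS.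
  case: i lt ez {lt' Gz ji sin} => [|i] lt ez; last first.
    by right; rewrite nthr /= ?(ltnW (ltnW lt)) // ez addnS.
  by rewrite addn0 in ez; rewrite ez eqxx in zn.
Qed.

(** * Pendant cycles and cycle graphs *)

(** Deleting [v] costs rank 2 and peeling [belast w q] costs [size q], together the length of the
    cycle. *)
Lemma tight_del_leaf_cycle (C : numClosedFieldType) n (phi : 'I_n -> 'I_n -> C)
  (G : rel 'I_n) v w q (s := [:: v, w & q]) :
  tight phi G -> is_cyc G s -> ~~ odd (size q) ->
  (forall a b, a \in s -> a != v -> G a b -> (a, b) \in cycle_edges s) ->
  tight phi (del_vertices [set x in s] G) /\
  rank_graph C G = (size s + rank_graph C (del_vertices [set x in s] G))%N.
Proof.
move=> t cs ev nb; have [gG _ _] := t.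
have us := is_cyc_uniq cs.
have ov : on_cycle G v by apply/on_cycleP; exists s; rewrite ?mem_head.
have [t1 r1 _] := tight_del_cycle_vertex t ov.
have e : take (size q) (drop 1 s) = belast w q.
  by rewrite /s [drop 1 _]/= lastI -cats1 take_size_cat ?size_belast.
have := @cycle_peelable _ _ _ _ 1 (size q) gG cs nb isT.
rewrite e size_belast => /(_ ev) pl.
(* The vertex [last w q] escapes the peeling, but its neighbours are all gone, so it is isolated and
   may be deleted too. *)
have eqK : del_vertices [set x in belast w q] (del_vertices [set v] G)
    =2 del_vertices [set x in s] G.
  have sE x : (x \in s) = [|| x == v, x \in belast w q | x == last w q].
    by rewrite /s inE lastI mem_rcons inE [(x == last w q) || _]orbC.
  have out x y : G x y -> x == last w q -> (x \in v :: belast w q) || (y \in v :: belast w q).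
    move=> Gxy /eqP xl; have xs : x \in s by rewrite sE xl eqxx !orbT.
    have [->|xv] := eqVneq x v; first by rewrite mem_head.
    have [_] := cycle_edges_mem us (nb _ _ xs xv Gxy).
    rewrite sE -xl [y == x]eq_sym (negPf (graph_neq gG Gxy)) orbF => h.
    by rewrite [X in _ || X]inE h orbT.
  move=> x y; rewrite del_verticesU /del_vertices !in_setU !in_set1.
  rewrite ![_ \in [set x in s]]in_set ![_ \in [set x in belast w q]]in_set !sE.
  case Gxy: (G x y); last by rewrite !andbF.
  have Gyx : G y x by rewrite gG.1.
  have := out _ _ Gxy; have := out _ _ Gyx; rewrite ![_ \in _ :: _]inE.
  case: (x == last w q); case: (y == last w q);
  case: (x == v); case: (y == v); case: (x \in belast w q); case: (y \in belast w q) => /= h1 h2;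
  by [|have := h1 isT|have := h2 isT].
have [g1 _ _] := t1.
have t2 := tight_peel t1 pl; split; first exact: eq_tight eqK t2.
rewrite r1 rank_graphE (rank_peel g1 (@unit_gain1 C _ _) pl) size_belast.
by rewrite (eq_rank_gain _ eqK) -rank_graphE.
Qed.

(** Here the neighbour [w] of [v] is deleted instead and all of [q] is peeled. The rank drop is the
    same, but [v] survives with its edges off the cycle. *)
Lemma tight_shrink_leaf_cycle (C : numClosedFieldType) n (phi : 'I_n -> 'I_n -> C)
  (G : rel 'I_n) v w q (s := [:: v, w & q]) :
  tight phi G -> is_cyc G s -> ~~ odd (size q) ->
  (forall a b, a \in s -> a != v -> G a b -> (a, b) \in cycle_edges s) ->
  tight phi (del_vertices [set x in w :: q] G) /\
  rank_graph C G = (size s + rank_graph C (del_vertices [set x in w :: q] G))%N.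
Proof.
move=> t cs ev nb; have [gG _ _] := t.
have ov : on_cycle G w by apply/on_cycleP; exists s; rewrite // !inE eqxx orbT.
have [t1 r1 _] := tight_del_cycle_vertex t ov.
have e : take (size q) (drop 2 s) = q by rewrite /s [drop 2 _]/= ?drop0 take_size.
have := @cycle_peelable _ _ _ _ 2 (size q) gG cs nb isT.
rewrite e => /(_ ev) pl.
have eqK : del_vertices [set x in q] (del_vertices [set w] G)
    =2 del_vertices [set x in w :: q] G.
  move=> x y; rewrite del_verticesU; congr (del_vertices _ _ _ _).
  by apply/setP=> z; rewrite !inE orbC.
have [g1 _ _] := t1.
have t2 := tight_peel t1 pl; split; first exact: eq_tight eqK t2.
rewrite r1 rank_graphE (rank_peel g1 (@unit_gain1 C _ _) pl).
by rewrite (eq_rank_gain _ eqK) -rank_graphE.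
Qed.

(** * Gains and kernel vectors on a single cycle *)

Lemma gain_ofE (C : numClosedFieldType) n (phi : 'I_n -> 'I_n -> C) s : uniq s ->
  gain_of phi s = \prod_(x <- s) phi x (next s x).
Proof.
move=> us; rewrite /gain_of.
suff -> : zip s (rot 1 s) = [seq (x, next s x) | x <- s] by rewrite big_map.
case: s us => [//|v t] us.
have sz : size (zip (v :: t) (rcons t v)) = size (v :: t).
  by rewrite size_zip size_rcons minnn.
rewrite rot1_cons; apply: (@eq_from_nth _ (v, v)); first by rewrite size_map.
rewrite sz => i lt.
rewrite (nth_map v) // nth_zip ?size_rcons // next_nth_head //; congr pair.
rewrite nth_rcons /=; case: (ltngtP i (size t)) => // h; last by rewrite h nth_default.
by rewrite nth_default // ltnW.
Qed.

Lemma gain_of_rot (C : numClosedFieldType) n (phi : 'I_n -> 'I_n -> C) i s : uniq s ->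
  gain_of phi (rot i s) = gain_of phi s.
Proof.
move=> us; rewrite !gain_ofE ?rot_uniq //.
rewrite (perm_big s) ?perm_rot //=; apply: eq_bigr => x _; by rewrite next_rot.
Qed.

Lemma next_next_neq n (G : rel 'I_n) s a : is_cyc G s -> a \in s ->
  next s (next s a) != a.
Proof.
move=> cs ain; have us := is_cyc_uniq cs; have [i p es] := rot_to ain.
rewrite -!(next_rot i us) es; move: (is_cyc_rot G i s); rewrite {}es cs.
case: p => [|b [|c p]] //= /and3P[_ /=]; rewrite eqxx !inE !negb_or.
case/and4P => /and3P[ab ac _] _ _ _ _.
by rewrite [b == a]eq_sym (negPf ab) eqxx eq_sym.
Qed.

Section CycleGraph.
Variables (C : numClosedFieldType) (n : nat) (G : rel 'I_n) (s : seq 'I_n).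
Hypotheses (gG : is_graph G) (cs : is_cyc G s).
Hypothesis sub : forall a b, G a b -> (a, b) \in cycle_edges s.

Let us : uniq s := is_cyc_uniq cs.

(** The neighbours of [next s a] are exactly its predecessor and successor on [s], which differ
    because the cycle has length at least 3. *)
Lemma cycle_col_sum (phi : 'I_n -> 'I_n -> C) (y : 'I_n -> C) a : a \in s ->
  \sum_x y x * gain_adj G phi x (next s a) =
  y a * phi a (next s a) + y (next s (next s a)) * phi (next s (next s a)) (next s a).
Proof.
move=> ain; set b := next s a; set c := next s b.
have bin : b \in s by rewrite mem_next.
have Gab : G a b := cycle_edges_adj gG cs (next_cycle_edges us ain).
have Gcb : G c b by rewrite gG.1; exact: cycle_edges_adj gG cs (next_cycle_edges us bin).
rewrite (bigD1 a) //= (bigD1 c) /=; last exact: next_next_neq cs ain.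
rewrite big1 => [|x /andP[xa xc]]; first by rewrite addr0 !mxE Gab Gcb.
rewrite mxE; case: ifP => [Gxb|_]; last by rewrite mulr0.
have := sub Gxb; rewrite mem_cycle_edges // => /orP[] /andP[xin /eqP e].
  by case/eqP: xa; rewrite -(prev_next us a) -/b e (prev_next us).
by rewrite e eqxx in xc.
Qed.

Lemma cycle_rank_rowsub (phi : 'I_n -> 'I_n -> C) :
  rank_gain G phi = \rank (rowsub (tnth (in_tuple s)) (gain_adj G phi)).
Proof.
apply/eqP; rewrite eqn_leq !mxrankS //; first by rewrite rowsubE submxMl.
apply/row_subP => x; have [xs|xs] := boolP (x \in s).
  have /tnthP[i ->] : x \in in_tuple s by [].
  by rewrite -row_rowsub row_sub.
rewrite (_ : row x _ = 0) ?sub0mx //; apply/rowP=> j; rewrite !mxE.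
by case: ifP => // /sub/(cycle_edges_mem us)[]; rewrite (negPf xs).
Qed.

Lemma cycle_rank_le (phi : 'I_n -> 'I_n -> C) : (rank_gain G phi <= size s)%N.
Proof. by rewrite cycle_rank_rowsub rank_leq_row. Qed.

(** Vertices off the cycle give zero rows and trivial kernel vectors, so only vectors supported on
    [s] count; they are the left kernel of the rows indexed by [s]. *)
Lemma cycle_rank_ltP (phi : 'I_n -> 'I_n -> C) :
  (rank_gain G phi < size s)%N <->
  exists y : 'rV[C]_n, [/\ y != 0, forall x, x \notin s -> y 0 x = 0 &
    y *m gain_adj G phi = 0].
Proof.
pose f (i : 'I_(size s)) := tnth (in_tuple s) i.
have f_inj : injective f by apply/tuple_uniqP.
have fP x : x \in s -> exists i, x = f i.
  by move=> xs; have /tnthP[i ->] : x \in in_tuple s by []; exists i.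
(* Multiplication by [rowsub f 1%:M] extends a vector on the cycle by zero. *)
have entry (c : 'rV[C]_(size s)) i : (c *m rowsub f 1%:M) 0 (f i) = c 0 i.
  rewrite mxE (bigD1 i) //= big1 => [|k ki]; last first.
    by rewrite !mxE (inj_eq f_inj) (negPf ki) mulr0.
  by rewrite !mxE eqxx mulr1 addr0.
have entry0 (c : 'rV[C]_(size s)) x : x \notin s -> (c *m rowsub f 1%:M) 0 x = 0.
  move=> xs; rewrite mxE big1 // => k _; rewrite !mxE.
  case: eqP => [e|_]; last by rewrite mulr0.
  by move: xs; rewrite -e (mem_tnth k (in_tuple s)).
rewrite cycle_rank_rowsub -/f ltn_neqAle rank_leq_row andbT -/(row_free _) -kermx_eq0; split.
  case/rowV0Pn => c /sub_kermxP ck c0; exists (c *m rowsub f 1%:M); split.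
  - apply: contra c0 => /eqP e; apply/eqP/rowP => i.
    by rewrite -entry e !mxE.
  - exact: entry0.
  - by rewrite -mulmxA -rowsubE.
case=> y [y0 ys yA]; pose c : 'rV[C]_(size s) := \row_i y 0 (f i).
have yc : y = c *m rowsub f 1%:M.
  apply/rowP => x; have [/fP[i ->]|xs] := boolP (x \in s).
    by rewrite entry mxE.
  by rewrite entry0 // ys.
apply/rowV0Pn; exists c; last by apply: contra y0 => /eqP e; rewrite yc e mul0mx.
by apply/sub_kermxP; rewrite rowsubE mulmxA -yc.
Qed.

(** Column [b = next s a] gives a relation between the entries at [a] and [c = next s b]; [phi b c]
    inverts [phi c b] by unimodularity. *)
Lemma cycle_kernel_step (phi : 'I_n -> 'I_n -> C) (y : 'rV[C]_n) a :
  unit_gain G phi -> y *m gain_adj G phi = 0 -> a \in s ->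
  y 0 (next s (next s a)) =
  - (y 0 a * (phi a (next s a) * phi (next s a) (next s (next s a)))).
Proof.
move=> ug yA ain; have := cycle_col_sum phi (fun x => y 0 x) ain.
have <- : (y *m gain_adj G phi) 0 (next s a) = \sum_x y 0 x * gain_adj G phi x (next s a).
  by rewrite mxE.
set b := next s a; set c := next s b; rewrite yA mxE => e.
have bin : b \in s by rewrite mem_next.
have [nbc cbc] := ug _ _ (cycle_edges_adj gG cs (next_cycle_edges us bin)).
have one : phi c b * phi b c = 1 by rewrite cbc mulrC -normCK nbc expr1n.
rewrite -[LHS]mulr1 -one mulrA; apply/eqP; rewrite -addr_eq0.
by rewrite [y 0 a * _]mulrA -mulrDl addrC -e mul0r.
Qed.
End CycleGraph.

(** The bound on [k] admits the full length, where [nth] returns its default [v] and the walk has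
    closed up. *)
Lemma cycle_kernel_iter (F : idomainType) n (y f : 'I_n -> F) v t k : uniq (v :: t) ->
  (forall a, a \in v :: t ->
     y (next (v :: t) (next (v :: t) a)) = - (y a * (f a * f (next (v :: t) a)))) ->
  (k.*2 <= size (v :: t))%N ->
  y (nth v (v :: t) k.*2) = (-1) ^+ k * (y v * \prod_(0 <= i < k.*2) f (nth v (v :: t) i)).
Proof.
move=> us step; elim: k => [|k IH] le; first by rewrite big_nil expr0 mul1r mulr1.
have lt : (k.*2.+1 < size (v :: t))%N by rewrite doubleS in le.
have := step (nth v (v :: t) k.*2); rewrite mem_nth ?(ltnW lt) // => /(_ isT).
rewrite !next_nth_head ?(ltnW lt) // doubleS => ->; rewrite IH; last by rewrite ltnW // ltnW.
by rewrite !big_nat_recr //= exprS !mulrA mulN1r !mulNr.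
Qed.

(* Going around the cycle in steps of two multiplies a kernel vector by
   [(-1) ^ (p / 2)] times the gain. *)
Lemma singular_cycle_gain (C : numClosedFieldType) n (G : rel 'I_n) (phi : 'I_n -> 'I_n -> C) s :
  is_graph G -> unit_gain G phi -> is_cyc G s -> (forall a b, G a b -> (a, b) \in cycle_edges s) ->
  ~~ odd (size s) -> (rank_gain G phi < size s)%N ->
  gain_of phi s = (-1) ^+ (size s %/ 2).
Proof.
move=> gG ug cs sub ev /(cycle_rank_ltP cs sub)[y [y0 ys yA]].
have us := is_cyc_uniq cs.
have [v yv] : exists v, y 0 v != 0.
  apply/existsP; move: y0; apply: contraR; rewrite negb_exists => /forallP h.
  by apply/eqP/rowP=> j; have /negPn/eqP-> := h j; rewrite mxE.
have vs : v \in s by apply: contraR yv => /ys->.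
have [i t es] := rot_to vs.
rewrite -(size_rot i) -(gain_of_rot _ i us) es.
have us' : uniq (v :: t) by rewrite -es rot_uniq.
have step a : a \in v :: t -> y 0 (next (v :: t) (next (v :: t) a)) =
    - (y 0 a * (phi a (next (v :: t) a) *
        phi (next (v :: t) a) (next (v :: t) (next (v :: t) a)))).
  by rewrite -es mem_rot !(next_rot i us); exact: (cycle_kernel_step gG cs sub ug yA).
have szE : ((size (v :: t)) %/ 2).*2 = size (v :: t).
  by rewrite divn2 even_halfK // -es size_rot.
have := @cycle_kernel_iter _ _ (fun x => y 0 x) (fun x => phi x (next (v :: t) x))
  v t (size (v :: t) %/ 2) us' step.
rewrite szE nth_default // => /(_ (leqnn _)) e.
rewrite gain_ofE // (big_nth v); set g := \prod_(_ <= _ < _) _ in e *.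
set m := (_ %/ 2)%N in e *.
(* After one turn the kernel vector is back at its nonzero value at [v]. *)
have one : (-1) ^+ m * g = 1.
  by apply: (mulfI yv); rewrite mulr1 {2}e !mulrA [y 0 v * _]mulrC.
by apply: (@mulfI _ ((-1) ^+ m)); rewrite ?signr_eq0 // one -expr2 sqrr_sign.
Qed.

Lemma index_next n (s : seq 'I_n) a : uniq s -> a \in s ->
  index (next s a) s =
  if ((index a s).+1 < size s)%N then (index a s).+1 else 0%N.
Proof.
case: s => [//|v t] us ain.
have lt : (index a (v :: t) < size (v :: t))%N by rewrite index_mem.
rewrite -{1}(nth_index v ain) next_nth_head //.
case: ifP => lt'; first by rewrite index_uniq.
by rewrite nth_default ?index_head // leqNgt lt'.
Qed.

(* The kernel vector is 1, 0, -1, 0 repeated around the cycle. *)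
Lemma cycle4_singular (C : numClosedFieldType) n (G : rel 'I_n) s :
  is_graph G -> is_cyc G s -> (forall a b, G a b -> (a, b) \in cycle_edges s) ->
  (4 %| size s)%N -> (rank_graph C G < size s)%N.
Proof.
move=> gG cs sub d4; rewrite rank_graphE; apply/(cycle_rank_ltP cs sub).
have us := is_cyc_uniq cs.
pose z i : C := if odd i then 0 else (-1) ^+ i./2.
have zSS i : z i.+2 = - z i.
  by rewrite /z /= negbK; case: ifP; rewrite ?oppr0 // exprS mulN1r.
have zp : z (size s) = 1.
  have /dvdnP[k ->] := d4; rewrite /z oddM /= andbF.
  by rewrite -[(k * 4)%N]/(k * (2 * 2))%N mulnA !muln2 doubleK -muln2 exprM sqrr_sign.
pose y : 'rV[C]_n := \row_x (if x \in s then z (index x s) else 0).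
exists y; split=> [|x xs|]; last 1 first.
- apply/rowP => b; rewrite !mxE.
  under eq_bigr => x _ do rewrite [y 0 x]mxE.
  have [bs|bs] := boolP (b \in s); last first.
    rewrite big1 // => x _; rewrite [X in _ * X]mxE; case: (boolP (G x b)) => [/sub|_].
      by case/(cycle_edges_mem us) => _; rewrite (negPf bs).
    by rewrite mulr0.
  rewrite -(next_prev us b); set a := prev s b.
  have ain : a \in s by rewrite mem_prev.
  rewrite (cycle_col_sum gG cs sub _ (fun x => if x \in s then z (index x s) else 0)) //.
  rewrite !mem_next ain !mulr1 !index_next ?mem_next //.
  (* Three cases: no wrap to index 0, a wrap at the second successor of [a], or a wrap at the
     first. *)
  case: ((index a s).+1 < size s)%N / idP => [lt1|/negP/negPf lt1].
    case: ifP => lt2; first by rewrite zSS addrN.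
    have e : (index a s).+2 = size s.
      by apply/eqP; rewrite eqn_leq lt1 /= leqNgt lt2.
    have h : 1 = - z (index a s) by rewrite -zSS e zp.
    by rewrite (_ : z 0%N = 1) // h addrN.
  have e : (index a s).+1 = size s.
    by apply/eqP; rewrite eqn_leq index_mem ain /= leqNgt lt1.
  have /and3P[s3 _ _] := cs; rewrite ifT; last by apply: leq_trans s3.
  have od : odd (index a s).
    have : ~~ odd (index a s).+1 by rewrite e; have /dvdnP[k ->] := d4; rewrite oddM andbF.
    by rewrite /= negbK.
  by rewrite /z od /= addr0.
- have [v vs] : exists v, v \in s.
    by have /and3P[s3 _ _] := cs; case: (s) s3 => // v t _; exists v; rewrite mem_head.
  have hs : head v s \in s by case: (s) vs => // a t _; rewrite mem_head.
  apply/eqP => /rowP/(_ (head v s)); rewrite !mxE hs.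
  have -> : index (head v s) s = 0%N by case: (s) vs => //= a t _; rewrite eqxx.
  by move/eqP; rewrite /z /= oner_eq0.
- by rewrite mxE (negPf xs).
Qed.

(** With [p = size s], [theta(G) >= 1] and [r(G) <= p] give [r(Phi) <= p - 2]. Peeling [p - 1]
    vertices excludes odd [p]; for even [p], peeling [p - 2] gives [r(Phi) = p - 2] and [r(G) = p].
    So [Phi] is singular on the cycle while [G] is not, which excludes [4 %| p]. *)
Lemma tight_cycle_graph (C : numClosedFieldType) n (G : rel 'I_n) (phi : 'I_n -> 'I_n -> C) s :
  tight phi G -> is_cyc G s -> (forall a b, G a b -> (a, b) \in cycle_edges s) ->
  (size s %% 4 = 2)%N /\ gain_of phi s = (-1) ^+ (size s %/ 2).
Proof.
move=> [gG ug t] cs sub; have us := is_cyc_uniq cs.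
case: s cs sub us => [//|v t0]; set s := v :: t0 => cs sub us.
have nb a b : a \in s -> a != v -> G a b -> (a, b) \in cycle_edges s.
  by move=> _ _; apply: sub.
have peel j : (0 < j)%N -> ~~ odd (size s - j) -> (size s - j <= rank_gain G phi)%N.
  move=> j0 ev; have := @cycle_peelable _ _ _ _ j (size s) gG cs nb j0.
  rewrite take_oversize; last by rewrite size_drop leq_subr.
  rewrite size_drop => /(_ ev) pl.
  have uH := unit_gain_sub (@del_vertices_sub _ [set nth v s j.-1] G) ug.
  have := rank_peel (del_vertices_graph _ gG) uH pl; rewrite size_drop => e.
  by apply: leq_trans (rank_del_vertices_le G phi [set nth v s j.-1]); rewrite e leq_addr.
have ov : on_cycle G v by apply/on_cycleP; exists s; rewrite ?mem_head.
have th : 1 <= theta G.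
  have vv : v \in [set v] by rewrite inE.
  apply: le_trans (theta_del_cycle_vertex gG ov vv).
  by rewrite -[X in X <= _]add0r lerD2r theta_ge0 //; apply: del_vertices_graph.
have rG := cycle_rank_le cs sub (fun _ _ => 1 : C); rewrite -rank_graphE in rG.
have /and3P[s3 _ _] := cs.
have lt2 : (rank_gain G phi + 2 <= size s)%N.
  by move: t th rG; move: (theta _) (rank_gain _ _) (rank_graph _ _); lia.
have ev : ~~ odd (size s).
  apply/negP => od; have := peel 1%N isT; rewrite subn1.
  by move: od s3 lt2; case: (size s) => [//|m] /= h _ lt /(_ h); lia.
have ge2 : (size s - 2 <= rank_gain G phi)%N by apply: peel => //; rewrite oddB ?(ltnW s3) // addbF.
have rp : rank_graph C G = size s.
  by move: t th rG lt2 ge2; move: (theta _) (rank_gain _ _) (rank_graph _ _); lia.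
split; last first.
  by apply: (singular_cycle_gain gG ug cs sub ev); apply: leq_trans lt2; rewrite addn2 ltnW.
have : ~~ (4 %| size s)%N.
  by apply/negP => /(cycle4_singular C gG cs sub); rewrite rp ltnn.
by lia.
Qed.

(** * Contraction of cycles *)

Lemma on_cycle_edge n (G : rel 'I_n) x : on_cycle G x -> exists y, G x y.
Proof.
by case/on_cycleP=> s /and3P[_ _ cy] xs; exists (next s x); apply: next_cycle cy xs.
Qed.

Lemma tight_cycle_type (C : numClosedFieldType) n (phi : 'I_n -> 'I_n -> C) (G : rel 'I_n) s :
  tight phi G -> is_cyc G s ->
  (size s %% 4 = 2)%N /\ gain_of phi s = (-1) ^+ (size s %/ 2).
Proof.
move=> t; have [gG _ _] := t; move: G gG t; apply: edges_ind => G gG IH t cs.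
have us := is_cyc_uniq cs; have dis := tight_disjoint t.
case: (boolP [exists x, on_cycle G x && (x \notin s)]).
  case/existsP=> x /andP[ox xs]; have [y Gxy] := on_cycle_edge ox.
  have [t1 _ _] := tight_del_cycle_vertex t ox.
  apply: (IH (del_vertices [set x] G) (del_vertices_graph _ gG) _ t1).
    by apply: edges_del_lt Gxy _; rewrite ?inE.
  by apply: is_cyc_del => // z zs; rewrite inE; apply: contraTneq zs => ->.
rewrite negb_exists => /forallP hs.
have ons x : on_cycle G x -> x \in s by move=> ox; have := hs x; rewrite ox negbK.
case: (boolP [exists a, exists b, G a b && ((a, b) \notin cycle_edges s)]); last first.
  rewrite negb_exists => /forallP h; apply: (tight_cycle_graph t cs) => a b Gab.
  by have := h a; rewrite negb_exists => /forallP/(_ b); rewrite Gab negbK.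
case/existsP=> a /existsP[b /andP[Gab ce]].
have br : bridge G a b.
  apply/negPn/negP => /(cycle_of_nonbridge gG Gab)[r cr cer].
  have [ar _] := cycle_edges_mem (is_cyc_uniq cr) cer.
  have as_ : a \in s by apply: ons; apply/on_cycleP; exists r.
  by move: ce; rewrite -(dis r s cr cs) ?cer //; exists a.
have [x0 x0s] : exists x0, x0 \in s.
  by have /and3P[s3 _ _] := cs; case: (s) s3 => // x0 r _; exists x0; rewrite mem_head.
(* The bridge is oriented away from [s]. As [s] carries all cycle vertices, the innermost bridge on
   that side can only cut off a pendant vertex. *)
have {ce} [a' [b' [br' nc]]] : exists a' b', bridge G a' b' /\ x0 \notin side G a' b'.
  have [h|] := boolP (x0 \in side G a b); last by exists a, b.
  exists b, a; rewrite bridgeC //; split=> //; apply/negP.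
  rewrite !inE in h *; rewrite (eq_connect (del_edgeC G b a)) => h'.
  have /andP[_ /negP[]] := br; apply: connect_trans h' _.
  by rewrite (graph_connect_sym (del_edge_graph a b gG)).
have [u [v [Guv vS [pend|[r [cr vr _ _]]]]]] := innermost_side gG dis br'; last first.
  have vs : v \in s by apply: ons; apply/on_cycleP; exists r.
  have /and3P[_ _ cy] := bridge_notin_cycle gG br' cs.
  case/negP: nc; rewrite !inE in vS *.
  exact: connect_trans vS (connect_cycle cy vs x0s).
have Gvu : G v u by rewrite gG.1.
have [t1 _ nu nv] := tight_del_pendant t Gvu pend.
apply: (IH (del_vertices [set u; v] G) (del_vertices_graph _ gG) _ t1).
  by apply: edges_del_lt Guv _; rewrite // !inE eqxx.
apply: is_cyc_del => // z zs; rewrite !inE; apply/norP; split.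
  by apply: contraNneq nu => <-; apply/on_cycleP; exists s.
by apply: contraNneq nv => <-; apply/on_cycleP; exists s.
Qed.

(** The relation behind [adjT], so that the rank lemmas for graphs apply to [T_G]; [off_cycles] does
    the same for [Gamma_G]. *)
Definition contracted n (G : rel 'I_n) : rel 'I_n := fun a b =>
  [&& is_rep G a, is_rep G b, a != b &
     [exists x, exists y, [&& same_node G a x, same_node G b y & G x y]]].

Definition off_cycles n (G : rel 'I_n) : rel 'I_n := fun a b =>
  [&& ~~ on_cycle G a, ~~ on_cycle G b & G a b].

Lemma rank_TE (C : numClosedFieldType) n (G : rel 'I_n) :
  rank_T C G = rank_gain (contracted G) (fun _ _ => 1 : C).
Proof. by rewrite -rank_graphE. Qed.

Lemma rank_GammaE (C : numClosedFieldType) n (G : rel 'I_n) :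
  rank_Gamma C G = rank_gain (off_cycles G) (fun _ _ => 1 : C).
Proof. by rewrite -rank_graphE. Qed.

Lemma contractedP n (G : rel 'I_n) a b :
  reflect ([/\ is_rep G a, is_rep G b, a != b &
    exists x y, [/\ same_node G a x, same_node G b y & G x y]]) (contracted G a b).
Proof.
apply: (iffP and4P) => -[ra rb ab h]; split=> //.
  by case/existsP: h => x /existsP[y /and3P[]]; exists x, y.
by case: h => x [y [h1 h2 h3]]; apply/existsP; exists x; apply/existsP; exists y; rewrite h1 h2.
Qed.

Lemma contracted_graph n (G : rel 'I_n) : is_graph G -> is_graph (contracted G).
Proof.
move=> gG; split=> [a b|a]; last by rewrite /contracted eqxx !andbF.
by apply/contractedP/contractedP => -[ra rb ab [x [y [h1 h2 h3]]]];
   split=> //; rewrite 1?eq_sym //; exists y, x; rewrite gG.1.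
Qed.

Lemma same_nodeC n (G : rel 'I_n) x y : same_node G x y = same_node G y x.
Proof.
by apply/same_nodeP/same_nodeP => -[->|[s []]]; [left|right; exists s|left|right; exists s].
Qed.

(** Such an [X] contains every cycle it meets, so deleting it commutes with contraction. *)
Definition cycle_closed n (G : rel 'I_n) (X : {set 'I_n}) := forall s x y,
  is_cyc G s -> x \in s -> y \in s -> x \in X -> y \in X.

Lemma same_node_del n (G : rel 'I_n) (X : {set 'I_n}) a z : cycle_closed G X ->
  a \notin X -> same_node (del_vertices X G) a z = same_node G a z.
Proof.
move=> cl aX; apply/same_nodeP/same_nodeP => -[->|[s [cs as_ zs]]]; try by left.
  right; exists s; split=> //; exact: is_cyc_sub (@del_vertices_sub _ _ _) cs.
right; exists s; split=> //; apply: is_cyc_del => // x xs.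
by apply: contra aX; apply: cl cs xs as_.
Qed.

Lemma same_node_closed n (G : rel 'I_n) (X : {set 'I_n}) a z : cycle_closed G X ->
  same_node G a z -> (z \in X) = (a \in X).
Proof.
move=> cl /same_nodeP[->//|[s [cs as_ zs]]].
by apply/idP/idP; apply: cl cs _ _.
Qed.

Lemma on_cycle_del n (G : rel 'I_n) (X : {set 'I_n}) a : cycle_closed G X ->
  on_cycle (del_vertices X G) a = on_cycle G a && (a \notin X).
Proof.
move=> cl; apply/on_cycleP/andP => [[s cs as_]|[/on_cycleP[s cs as_] aX]].
  split; last exact: is_cyc_del_notin cs as_.
  by apply/on_cycleP; exists s => //; apply: is_cyc_sub (@del_vertices_sub _ _ _) cs.
exists s => //; apply: is_cyc_del => // x xs.
by apply: contra aX; apply: cl cs xs as_.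
Qed.

(** A class of [same_node] lies inside [X] or is untouched; in the latter case its least element,
    the representative, is unchanged. *)
Lemma contracted_del n (G : rel 'I_n) (X : {set 'I_n}) : cycle_closed G X ->
  contracted (del_vertices X G) =2 del_vertices X (contracted G).
Proof.
move=> cl a b.
have out a' x : same_node (del_vertices X G) a' x -> x \notin X -> a' \notin X.
  case/same_nodeP => [<-//|[s [cs as_ _]] _].
  exact: is_cyc_del_notin cs as_.
have rep a' : a' \notin X -> is_rep (del_vertices X G) a' = is_rep G a'.
  by move=> aX; apply: eq_forallb => z; rewrite same_node_del.
apply/contractedP/and3P => [[ra rb ab [x [y [sa sb /and3P[xX yX Gxy]]]]]|].
  have aX := out _ _ sa xX; have bX := out _ _ sb yX.
  split=> //; apply/contractedP; rewrite -!rep //; split=> //.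
  by exists x, y; rewrite -!(same_node_del _ cl).
case=> aX bX /contractedP[ra rb ab [x [y [sa sb Gxy]]]]; rewrite !rep //; split=> //.
exists x, y; rewrite !same_node_del //; split=> //; rewrite /del_vertices Gxy.
by rewrite (same_node_closed cl sa) aX (same_node_closed cl sb) bX.
Qed.

Lemma off_cycles_del n (G : rel 'I_n) (X : {set 'I_n}) : cycle_closed G X ->
  off_cycles (del_vertices X G) =2 del_vertices X (off_cycles G).
Proof.
move=> cl a b; rewrite /off_cycles !on_cycle_del // /del_vertices.
by case: (a \in X); case: (b \in X); rewrite ?andbF ?andbT.
Qed.

(** A nonempty such [S] is what contracts to one vertex of [T_G]. *)
Definition is_node n (G : rel 'I_n) (S : {set 'I_n}) :=
  forall x z, x \in S -> same_node G x z = (z \in S).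

Lemma node_rep_unique n (G : rel 'I_n) (S : {set 'I_n}) a b : is_node G S ->
  a \in S -> b \in S -> is_rep G a -> is_rep G b -> a = b.
Proof.
move=> nS aS bS /forallP/(_ b) + /forallP/(_ a); rewrite !nS // aS bS /= => h1 h2.
by apply: val_inj; apply/eqP; rewrite eqn_leq h1 h2.
Qed.

(** The least element [t] of [S] represents it and is pendant at [u] in the contracted graph, so
    [rank_pendant] applies there. *)
Lemma rank_T_leaf (C : numClosedFieldType) n (G : rel 'I_n) (S : {set 'I_n}) v u :
  is_graph G -> is_node G S -> cycle_closed G (u |: S) -> u \notin S ->
  ~~ on_cycle G u -> v \in S -> G v u ->
  (forall a b, a \in S -> b \notin S -> G a b -> b = u) ->
  rank_T C G = (rank_T C (del_vertices (u |: S) G)).+2.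
Proof.
move=> gG nS cl uS nu vS Gvu out.
have sameu z : same_node G u z = (z == u).
  apply/same_nodeP/eqP => [[->//|[s [cs us _]]]|->]; last by left.
  by case/negP: nu; apply/on_cycleP; exists s.
case: (@arg_minnP _ v (mem S) (fun x => x) vS) => t tS tmin.
have rt : is_rep G t by apply/forallP => z; rewrite nS //; apply/implyP; apply: tmin.
have ru : is_rep G u by apply/forallP => z; rewrite sameu; apply/implyP => /eqP->.
have tu : t != u by apply: contraNneq uS => <-.
have Ttu : contracted G t u.
  apply/contractedP; split=> //; exists v, u; split=> //; first by rewrite nS.
  by rewrite sameu.
have pend z : contracted G t z -> z = u.
  case/contractedP => _ rz tz [x [y [sx sy Gxy]]].
  have xS : x \in S by rewrite -(nS t).
  have [yS|yS] := boolP (y \in S).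
    have zS : z \in S by rewrite same_nodeC nS in sy.
    by rewrite (node_rep_unique nS tS zS rt rz) eqxx in tz.
  have yu := out _ _ xS yS Gxy; rewrite yu same_nodeC sameu in sy.
  exact/eqP.
rewrite !rank_TE (rank_pendant (contracted_graph gG) (@unit_gain1 _ _ _) Ttu pend).
congr _.+2; apply: eq_rank_gain => a b; rewrite contracted_del // /del_vertices.
have [h|_] := boolP (contracted G a b); last by rewrite !andbF.
have /contractedP[ra rb _ _] := h.
(* The elements of [S] other than [t] are no representatives, so deleting [S] or only [t] gives the
   same contracted edges. *)
have eS c : is_rep G c -> (c \in S) = (c == t).
  move=> rc; apply/idP/eqP => [cS|->//]; exact: node_rep_unique nS cS tS rc rt.
by rewrite !inE !eS.
Qed.

Lemma rank_T_isolated (C : numClosedFieldType) n (G : rel 'I_n) (S : {set 'I_n}) :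
  is_graph G -> is_node G S -> cycle_closed G S ->
  (forall a b, a \in S -> G a b -> b \in S) ->
  rank_T C G = rank_T C (del_vertices S G).
Proof.
move=> gG nS cl out; rewrite !rank_TE; apply: eq_rank_gain => a b.
have noT c d : contracted G c d -> c \notin S.
  case/contractedP => rc rd cd [x [y [sx sy Gxy]]]; apply/negP => cS.
  have yS : y \in S by apply: out Gxy; rewrite -(nS c).
  have dS : d \in S by rewrite same_nodeC nS in sy.
  by rewrite (node_rep_unique nS cS dS rc rd) eqxx in cd.
rewrite contracted_del // /del_vertices.
have [h|_] := boolP (contracted G a b); last by rewrite !andbF.
by rewrite (noT a b) // (noT b a) // (contracted_graph gG).1.
Qed.

(** * The set of cycles under deletion *)

Lemma cycles_del_acyclic n (G : rel 'I_n) (X : {set 'I_n}) :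
  (forall x, x \in X -> ~~ on_cycle G x) -> cycles (del_vertices X G) = cycles G.
Proof.
move=> nX; apply/setP => E; apply/cyclesP/cyclesP => -[s cs <-]; exists s => //.
  exact: is_cyc_sub (@del_vertices_sub _ _ _) cs.
apply: is_cyc_del => // x xs; apply/negP => /nX/negP[].
by apply/on_cycleP; exists s.
Qed.

Lemma sum_cycles_del n (G : rel 'I_n) (X : {set 'I_n}) s : cycles_disjoint G ->
  is_cyc G s -> (forall x, x \in s -> x \in X) ->
  (forall x, x \in X -> on_cycle G x -> x \in s) ->
  (\sum_(E in cycles G) #|vset E| =
   size s + \sum_(E in cycles (del_vertices X G)) #|vset E|)%N.
Proof.
move=> dis cs sX Xs; have us := is_cyc_uniq cs.
have [x0 x0s] : exists x0, x0 \in s.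
  by have /and3P[s3 _ _] := cs; case: (s) s3 => // x0 r _; exists x0; rewrite mem_head.
have -> : cycles G = cycle_edges s |: cycles (del_vertices X G).
  apply/setP => E; rewrite in_setU1; apply/cyclesP/orP => [[r cr <-]|[/eqP->|/cyclesP[r cr <-]]].
  - have [/hasP[x xr xs]|/hasPn h] := boolP (has (mem s) r).
      by left; apply/eqP; apply: dis => //; exists x.
    right; apply/cyclesP; exists r => //; apply: is_cyc_del => // x xr.
    apply/negP => xX; have := h x xr; rewrite /= Xs //.
    by apply/on_cycleP; exists r.
  - by exists s.
  - by exists r => //; apply: is_cyc_sub (@del_vertices_sub _ _ _) cr.
rewrite big_setU1 /=; first by rewrite vset_cycle_edges // cardsE (card_uniqP us).
apply/negP => /cyclesP[r cr e].
have /setP/(_ x0) : vset (cycle_edges r) = vset (cycle_edges s) by rewrite e.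
rewrite !vset_cycle_edges ?(is_cyc_uniq cr) // !inE x0s => x0r.
by have := is_cyc_del_notin cr x0r; rewrite sX.
Qed.

Lemma cycle_node n (G : rel 'I_n) s : cycles_disjoint G -> is_cyc G s ->
  is_node G [set x in s].
Proof.
move=> dis cs x z; rewrite !inE => xs; apply/same_nodeP/idP => [[<-//|[r [cr xr zr]]]|zs].
  by rewrite -(cycles_disjoint_mem dis cr cs xr xs).
by right; exists s.
Qed.

Lemma cycle_closed_acyclic n (G : rel 'I_n) (X : {set 'I_n}) :
  (forall x, x \in X -> ~~ on_cycle G x) -> cycle_closed G X.
Proof.
by move=> nX s x y cs xs _ /nX/negP[]; apply/on_cycleP; exists s.
Qed.

Lemma cycle_closedU n (G : rel 'I_n) (X Y : {set 'I_n}) :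
  cycle_closed G X -> cycle_closed G Y -> cycle_closed G (X :|: Y).
Proof.
move=> cX cY s x y cs xs ys; rewrite !inE => /orP[h|h].
  by rewrite (cX s x y).
by rewrite (cY s x y) ?orbT.
Qed.

Lemma cycle_closed_cycle n (G : rel 'I_n) s : cycles_disjoint G -> is_cyc G s ->
  cycle_closed G [set x in s].
Proof.
move=> dis cs r x y cr xr yr; rewrite !inE => xs.
by rewrite -(cycles_disjoint_mem dis cr cs xr xs).
Qed.

Lemma cycle_rooted n (G : rel 'I_n) s v : is_cyc G s -> v \in s ->
  exists w q, [/\ is_cyc G [:: v, w & q], [:: v, w & q] =i s &
    cycle_edges [:: v, w & q] = cycle_edges s].
Proof.
move=> cs vs; have us := is_cyc_uniq cs; have [i t es] := rot_to vs.
have := cycle_edges_rot i us; have := is_cyc_rot G i s; have := mem_rot i s.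
rewrite es cs; case: t es => [|w q] _ m c e; first by move: c; rewrite /is_cyc.
by exists w, q.
Qed.

(** * Induction for the two rank formulas *)

Definition rank_splits (C : numClosedFieldType) n (G : rel 'I_n) :=
  rank_graph C G = (rank_T C G + \sum_(E in cycles G) #|vset E|)%N /\
  rank_T C G = rank_Gamma C G.

Lemma rank_splits_empty (C : numClosedFieldType) n (G : rel 'I_n) :
  G =2 (fun _ _ => false) -> rank_splits C G.
Proof.
move=> e; have cyc s : is_cyc G s -> False.
  by case: s => [//|x s] /and3P[_ _ cy]; have := next_cycle cy (mem_head x s); rewrite e.
rewrite /rank_splits rank_graphE rank_TE rank_GammaE !rank_empty //.
- by rewrite big1 // => E /cyclesP[s /cyc].
- by move=> a b; rewrite /off_cycles e !andbF.
- move=> a b; apply/contractedP => -[_ _ _ [x [y [_ _]]]]; by rewrite e.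
Qed.

(** Neither [u] nor [v] is on a cycle, so [v] is pendant at [u] in [T_G] and in [Gamma_G] as well:
    all three ranks drop by 2 and the cycles stay. *)
Lemma rank_splits_pendant (C : numClosedFieldType) n (phi : 'I_n -> 'I_n -> C)
  (G : rel 'I_n) v u :
  tight phi G -> G v u -> (forall z, G v z -> z = u) ->
  rank_splits C (del_vertices [set u; v] G) -> rank_splits C G.
Proof.
move=> t Gvu pend [IH1 IH2]; have [gG _ _] := t.
have [_ r nu nv] := tight_del_pendant t Gvu pend.
have nX x : x \in [set u; v] -> ~~ on_cycle G x by rewrite !inE => /orP[] /eqP->.
have cl := cycle_closed_acyclic nX.
have rT : rank_T C G = (rank_T C (del_vertices [set u; v] G)).+2.
  apply: (rank_T_leaf C gG _ cl _ nu _ Gvu).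
  - move=> x z; rewrite !inE => /eqP->; apply/same_nodeP/eqP => [[->//|[s [cs vs _]]]|->].
      by case/negP: nv; apply/on_cycleP; exists s.
    by left.
  - by rewrite inE eq_sym (graph_neq gG).
  - by rewrite inE.
  - by move=> a b; rewrite !inE => /eqP-> _; apply: pend.
have rG : rank_Gamma C G = (rank_Gamma C (del_vertices [set u; v] G)).+2.
  have gO : is_graph (off_cycles G).
    split=> [a b|a]; last by rewrite /off_cycles gG.2 !andbF.
    by rewrite /off_cycles gG.1 andbCA.
  rewrite !rank_GammaE (rank_pendant gO (@unit_gain1 _ _ _) (v := v) (u := u)).
  - by congr _.+2; apply: eq_rank_gain => a b; rewrite off_cycles_del.
  - by rewrite /off_cycles nu nv.
  - by move=> z /and3P[_ _]; apply: pend.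
split; last by rewrite rT rG IH2.
by rewrite r rT IH1 (cycles_del_acyclic nX) !addSn.
Qed.

Lemma off_cycles_del_cycle n (G : rel 'I_n) s : cycles_disjoint G -> is_cyc G s ->
  off_cycles (del_vertices [set x in s] G) =2 off_cycles G.
Proof.
move=> dis cs a b; rewrite (off_cycles_del (cycle_closed_cycle dis cs)).
rewrite /off_cycles /del_vertices !inE.
have h c : c \in s -> on_cycle G c by move=> c_; apply/on_cycleP; exists s.
case: (boolP (a \in s)) => [/h->//|_]; case: (boolP (b \in s)) => [/h->|_] //.
by rewrite !andbF.
Qed.

(** The cycle contracts to an isolated vertex of [T_G] and is absent from [Gamma_G], so only [r(G)]
    and the sum change, both by its length. *)
Lemma rank_splits_isolated_cycle (C : numClosedFieldType) n (phi : 'I_n -> 'I_n -> C)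
  (G : rel 'I_n) s :
  tight phi G -> is_cyc G s -> (forall a b, a \in s -> G a b -> (a, b) \in cycle_edges s) ->
  tight phi (del_vertices [set x in s] G) /\
  (rank_splits C (del_vertices [set x in s] G) -> rank_splits C G).
Proof.
move=> t cs nb; have [gG _ _] := t; have dis := tight_disjoint t.
have us := is_cyc_uniq cs.
have [v vs] : exists v, v \in s.
  by have /and3P[s3 _ _] := cs; case: (s) s3 => // v r _; exists v; rewrite mem_head.
have [w [q [cs' m ce]]] := cycle_rooted cs vs.
have setE : [set x in [:: v, w & q]] = [set x in s] by apply/setP => x; rewrite !in_set m.
have sz : size [:: v, w & q] = size s.
  by apply/eqP; rewrite -uniq_size_uniq // (is_cyc_uniq cs').
have [s4 _] := tight_cycle_type t cs'.
have ev : ~~ odd (size q) by move: s4; rewrite /=; lia.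
have nb' a b : a \in [:: v, w & q] -> a != v -> G a b -> (a, b) \in cycle_edges [:: v, w & q].
  by rewrite m ce => as_ _; apply: nb.
have [tK rK] := tight_del_leaf_cycle t cs' ev nb'.
rewrite setE in tK rK; split; first exact: tK.
have clS := cycle_closed_cycle dis cs.
have rT : rank_T C G = rank_T C (del_vertices [set x in s] G).
  apply: (rank_T_isolated C gG (cycle_node dis cs) clS) => a b; rewrite !inE => as_ Gab.
  by have [] := cycle_edges_mem us (nb _ _ as_ Gab).
have rG : rank_Gamma C G = rank_Gamma C (del_vertices [set x in s] G).
  rewrite !rank_GammaE; apply: eq_rank_gain => a b.
  by rewrite off_cycles_del_cycle.
case=> IH1 IH2; rewrite /rank_splits rT rG rK IH1 sz (@sum_cycles_del _ G [set x in s] s) //.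
- by rewrite addnCA.
- by move=> x xs; rewrite inE.
- by move=> x; rewrite inE.
Qed.

(** The graph without [u] and [s] yields the formula for [r(G)]. Comparing it with the formula for
    [G - s] gives [r(T_G) = r(T_(G - s))], and [G - s] has the same [Gamma] as [G]. *)
Lemma rank_splits_pendant_cycle (C : numClosedFieldType) n (phi : 'I_n -> 'I_n -> C)
  (G : rel 'I_n) s v u (X := [set x in s]) :
  tight phi G -> is_cyc G s -> v \in s -> u \notin s -> G v u ->
  (forall a b, a \in s -> G a b -> (a, b) \in cycle_edges s \/ (a = v /\ b = u)) ->
  [/\ tight phi (del_vertices X G), tight phi (del_vertices (u |: X) G) &
      rank_splits C (del_vertices X G) -> rank_splits C (del_vertices (u |: X) G) ->
      rank_splits C G].
Proof.
move=> t cs vs nus Gvu nb; have [gG _ _] := t; have dis := tight_disjoint t.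
have us := is_cyc_uniq cs.
have [w [q [cs' m ce]]] := cycle_rooted cs vs.
have us' := is_cyc_uniq cs'.
have setE : [set x in [:: v, w & q]] = X by apply/setP => x; rewrite !in_set m.
have sz : size [:: v, w & q] = size s by apply/eqP; rewrite -uniq_size_uniq.
have [s4 _] := tight_cycle_type t cs'.
have ev : ~~ odd (size q) by move: s4; rewrite /=; lia.
have nb' a b : a \in [:: v, w & q] -> a != v -> G a b -> (a, b) \in cycle_edges [:: v, w & q].
  rewrite m ce => as_ av Gab; have [//|[e _]] := nb _ _ as_ Gab.
  by rewrite e eqxx in av.
have [tK rK] := tight_del_leaf_cycle t cs' ev nb'.
have [t1 r1] := tight_shrink_leaf_cycle t cs' ev nb'.
rewrite setE in tK rK.
set G1 := del_vertices [set x in w :: q] G in t1 r1.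
have vwq : v \notin w :: q by case/andP: us'.
have uwq : u \notin w :: q by apply: contra nus => h; rewrite -m inE h orbT.
have G1vu : G1 v u by rewrite /G1 /del_vertices !in_set vwq uwq.
have pend z : G1 v z -> z = u.
  case/and3P => _; rewrite in_set => zn Gvz; have [cez|[]//] := nb _ _ vs Gvz.
  have [_] := cycle_edges_mem us cez; rewrite -m inE (negPf zn) orbF => /eqP e.
  by rewrite e gG.2 in Gvz.
have [t2 r2 nu1 _] := tight_del_pendant t1 G1vu pend.
have eq2 : del_vertices [set u; v] G1 =2 del_vertices (u |: X) G.
  move=> a b; rewrite del_verticesU; congr (del_vertices _ _ _ _).
  by rewrite -setE; apply/setP => z; rewrite !inE -!orbA.
(* A cycle of [G] through [u] is disjoint from [s], so it would survive in [G1], where [u] is next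
   to a pendant vertex. *)
have nu : ~~ on_cycle G u.
  apply: contra nu1 => /on_cycleP[r cr ur]; apply/on_cycleP; exists r => //.
  apply: is_cyc_del => // x xr; rewrite in_set; apply: contra nus => xq.
  have xs : x \in s by rewrite -m inE xq orbT.
  by rewrite -(cycles_disjoint_mem dis cr cs xr xs).
have nXu x : x \in [set u] -> ~~ on_cycle G x by rewrite inE => /eqP->.
have clX := cycle_closed_cycle dis cs.
have clu : cycle_closed G (u |: X) := cycle_closedU (cycle_closed_acyclic nXu) clX.
have rT : rank_T C G = (rank_T C (del_vertices (u |: X) G)).+2.
  apply: (rank_T_leaf C gG (cycle_node dis cs) clu _ nu _ Gvu); rewrite ?inE //.
  move=> a b; rewrite !inE => as_ bs Gab; have [cea|[]//] := nb _ _ as_ Gab.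
  by have [_] := cycle_edges_mem us cea; rewrite (negPf bs).
have rG : rank_Gamma C G = rank_Gamma C (del_vertices X G).
  rewrite !rank_GammaE; apply: eq_rank_gain => a b.
  by rewrite off_cycles_del_cycle.
have sumX : (\sum_(E in cycles G) #|vset E| =
    size s + \sum_(E in cycles (del_vertices X G)) #|vset E|)%N.
  by apply: sum_cycles_del => // x; rewrite inE.
have sumuX : (\sum_(E in cycles G) #|vset E| =
    size s + \sum_(E in cycles (del_vertices (u |: X) G)) #|vset E|)%N.
  apply: sum_cycles_del => // x; rewrite !inE; first by move=> ->; rewrite orbT.
  by case/orP => // /eqP->; rewrite (negPf nu).
have r2' : rank_graph C G1 = (rank_graph C (del_vertices (u |: X) G)).+2.
  by rewrite r2 !rank_graphE (eq_rank_gain _ eq2).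
split; [exact: tK | exact: eq_tight eq2 t2 |].
move=> [K1 K2] [U1 U2]; rewrite sz in rK r1.
have main : rank_graph C G = (rank_T C G + \sum_(E in cycles G) #|vset E|)%N.
  by rewrite r1 r2' U1 sumuX rT [RHS]addnCA !addSn.
split; first exact: main.
by move: main; rewrite rG -K2 rK K1 sumX [RHS]addnCA => /addnI/addIn.
Qed.

Lemma tight_rank_splits (C : numClosedFieldType) n (phi : 'I_n -> 'I_n -> C)
  (G : rel 'I_n) : tight phi G -> rank_splits C G.
Proof.
move=> t; have [gG _ _] := t; move: G gG t; apply: edges_ind => G gG IH t.
have dis := tight_disjoint t.
have [e|[x [y Gxy]]] := empty_or_edge G; first exact: rank_splits_empty.
have IHX (X : {set 'I_n}) a b : G a b -> a \in X -> tight phi (del_vertices X G) ->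
    rank_splits C (del_vertices X G).
  by move=> Gab aX; apply: IH (del_vertices_graph _ gG) (edges_del_lt gG Gab aX).
have [/existsP[a /existsP[b br]]|] := boolP [exists a, exists b, bridge G a b].
  have [u [v [Guv _ [pend|[s [cs vs nus nb]]]]]] := innermost_side gG dis br.
    have Gvu : G v u by rewrite gG.1.
    apply: (rank_splits_pendant t Gvu pend).
    have [t1 _ _ _] := tight_del_pendant t Gvu pend.
    by apply: IHX Guv _ t1; rewrite !inE eqxx.
  have Gvu : G v u by rewrite gG.1.
  have [tK tU h] := rank_splits_pendant_cycle t cs vs nus Gvu nb.
  by apply: h; [apply: IHX Gvu _ tK | apply: IHX Guv _ tU]; rewrite !inE ?eqxx.
rewrite negb_exists => /forallP nbr.
have nonbr a b : ~~ bridge G a b.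
  by have := nbr a; rewrite negb_exists => /forallP.
have [s cs ces] := cycle_of_nonbridge gG Gxy (nonbr _ _).
have [xs _] := cycle_edges_mem (is_cyc_uniq cs) ces.
(* Without bridges every edge at [s] lies on a cycle meeting [s], which is [s] itself: [s] is a
   whole component. *)
have nb a b : a \in s -> G a b -> (a, b) \in cycle_edges s.
  move=> as_ Gab; have [r cr cer] := cycle_of_nonbridge gG Gab (nonbr _ _).
  have [ar _] := cycle_edges_mem (is_cyc_uniq cr) cer.
  by rewrite -(dis r s) //; exists a.
have [tK] := rank_splits_isolated_cycle t cs nb; apply.
by apply: IHX Gxy _ tK; rewrite inE.
Qed.

Theorem theorem4p6 (C : numClosedFieldType) (n : nat) (G : rel 'I_n)
    (phi : 'I_n -> 'I_n -> C) :
  symmetric G -> irreflexive G -> unit_gain G phi ->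
  (rank_gain G phi)%:Z = (rank_graph C G)%:Z - 2 * theta G ->
  [/\ (* (a) distinct cycles are vertex-disjoint *)
      (forall s1 s2 : seq 'I_n, is_cyc G s1 -> is_cyc G s2 ->
         (exists2 x, x \in s1 & x \in s2) -> cycle_edges s1 = cycle_edges s2),
      (* (b) every gain cycle is of Type A with p = 2 mod 4 *)
      (forall s : seq 'I_n, is_cyc G s ->
         (size s %% 4 = 2)%N /\ gain_of phi s = (-1) ^+ (size s %/ 2)),
      (* (c) *)
      rank_graph C G = (rank_T C G + \sum_(E in cycles G) #|vset E|)%N
    & rank_T C G = rank_Gamma C G].
Proof.
move=> sG iG ug e; have t : tight phi G by split; [split | exact: ug | exact: e].
have [c1 c2] := tight_rank_splits t.
split; [exact: tight_disjoint t | | exact: c1 | exact: c2].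
by move=> s; apply: tight_cycle_type.
Qed.
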